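(* Let $N$ be a complex Sasakian manifold with structure $(G,H,J,U,V,u,v,g)$, and let $B$ be the $(0,4)$-tensor on $N$ defined by $$\begin{aligned}B(X,Y,Z,W)={}&a_0R(X,Y,Z,W)+a_1R(X,Z,Y,W)+a_2\rho(Y,Z)g(X,W)+a_3\rho(X,Z)g(Y,W)\\&+a_4\rho(X,Y)g(Z,W)+a_5\rho(X,W)g(Y,Z)+a_6\rho(Y,W)g(X,Z)+a_7\rho(Z,W)g(X,Y)\\&+\tau\{a_8g(X,W)g(Y,Z)+a_9g(X,Z)g(Y,W)+a_{10}g(X,Y)g(Z,W)\},\end{aligned}$$ where $a_0,\dots,a_{10}$ are scalars on $N$. Then $N$ is not $B$-flat, i.e. $B$ does not vanish identically on $N$.
   Context: Complex Sasakian manifold. Let $N$ be a complex manifold of complex dimension $2p+1$, $p\ge 1$, with complex structure $J$ and Hermitian metric $g$, and let $\nabla$ be the Levi-Civita connection of $g$. Suppose there is a globally defined holomorphic $1$-form $\eta$ on $N$ with $\eta\wedge(d\eta)^p\neq 0$ everywhere, written $\eta=u-iv$ with $u$ and $v=u\circ J$ real $1$-forms. Let $U$ and $V=-JU$ be the vector fields dual to $u$ and $v$, that is $u(\cdot)=g(U,\cdot)$, $v(\cdot)=g(V,\cdot)$, with $u(U)=v(V)=1$ and $u(V)=v(U)=0$. Suppose there are $(1,1)$-tensor fields $G$ and $H=GJ$ with $$G^2=H^2=-I+u\otimes U+v\otimes V,\quad GJ=-JG,\quad GU=0,\quad g(X,GY)=-g(GX,Y).$$ Exterior derivatives of $1$-forms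 use the convention $2\,d\omega(X,Y)=X\omega(Y)-Y\omega(X)-\omega([X,Y])$. Put $\sigma(X)=g(\nabla_XU,V)$. A vector field $X$ is horizontal if $u(X)=v(X)=0$; $\mathcal H$ denotes the distribution of horizontal vectors. For a $(1,1)$-tensor $F$ let $[F,F](X,Y)=(\nabla_{FX}F)Y-(\nabla_{FY}F)X-F(\nabla_XF)Y+F(\nabla_YF)X$, and define $$\begin{aligned}S(X,Y)={}&[G,G](X,Y)+2g(X,GY)U-2g(X,HY)V+2(v(Y)HX-v(X)HY)\\&+\sigma(GY)HX-\sigma(GX)HY+\sigma(X)GHY-\sigma(Y)GHX,\\ T(X,Y)={}&[H,H](X,Y)-2g(X,GY)U+2g(X,HY)V+2(u(Y)GX-u(X)GY)\\&+\sigma(HX)GY-\sigma(HY)GX+\sigma(X)GHY-\sigma(Y)GHX.\end{aligned}$$ The structure is normal if $S(X,Y)=T(X,Y)=0$ for all $X,Y\in\mathcal H$ and $S(X,U)=T(X,V)=0$ for all $X$. $N$ with the structure $(G,H,J,U,V,u,v,g)$ is a complex Sasakian manifold if it is normal and the fundamental $2$-forms $\widetilde G(X,Y)=g(X,GY)$, $\widetilde H(X,Y)=g(X,HY)$ satisfy $\widetilde G=du$ and $\widetilde H=dv$. Curvature conventions: $R(X,Y)Z=\nabla_X\nabla_YZ-\nabla_Y\nabla_XZ-\nabla_{[X,Y]}Z$, $R(X,Y,Z,W)=g(R(X,Y)Z,W)$; $\rho$ is the Ricci tensor and $\tau$ the scalar curvature of $g$.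
   Formalization: The formal theorem assumes in addition that at least one of the scalars a_0,...,a_10 is nonzero at some point of N; if all of them vanish identically then B = 0 and the statement is false. *)

(* Defs.v *)
(* MathComp / MathComp-Analysis *)
From HB Require Import structures.
From mathcomp Require Import all_boot all_order all_algebra all_fingroup.
From mathcomp Require Import all_classical all_reals all_analysis.
From mathcomp Require Import complex.

Set Implicit Arguments.
Unset Strict Implicit.
Unset Printing Implicit Defensive.
Import Order.TTheory GRing.Theory Num.Theory.
Import numFieldNormedType.Exports.
Local Open Scope classical_set_scope.
Local Open Scope ring_scope.
Local Open Scope complex_scope.

(* C^n is modelled on row vectors of R^n + R^n: the vector (x, y) stands for   *)
(* x + i y. Tangent vectors are row vectors of components; linear maps act on  *)
(* them by multiplication on the right, as in the library's Jacobian 'J f p,   *)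
(* for which 'D_w f p = w *m 'J f p.                                           *)

Section LocalCalculus.
Context {R : realType} {n : nat}.
Local Notation m := (n + n)%N.
Local Notation E := 'rV[R]_m.
(* A vector field, in a chart. *)
Local Notation vf := (E -> E).
Implicit Types (O : set E) (X Y Z W : vf).

(* C^oo on the open set O: all iterated directional derivatives exist and are  *)
(* differentiable at every point of O.                                         *)
Definition smooth_on (T : normedModType R) O (f : E -> T) :=
  forall (s : seq E) y, O y ->
    differentiable (foldr (fun w (h : E -> T) => 'D_w h) f s) y.

(* Multiplication by i on C^n: (x, y) |-> (- y, x). *)
Definition J0 : 'M[R]_m := block_mx 0 1%:M (- 1%:M) 0.

(* Smooth, with a complex-linear differential (Cauchy-Riemann). *)
Definition holomorphic_on O (f : E -> R[i]) :=
  let df w y := ('D_w (fun z => complex.Re (f z)) y) +i* ('D_w (fun z => complex.Im (f z)) y) in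
  [/\ smooth_on O (fun z => complex.Re (f z)),
      smooth_on O (fun z => complex.Im (f z)) &
      forall w y, O y -> df (w *m J0) y = (0 +i* 1) * df w y].

Definition holomorphic_map_on O (f : E -> E) :=
  forall k : 'I_n, holomorphic_on O (fun z => (f z 0 (lshift n k)) +i* (f z 0 (rshift n k))).

Definition form_app (w : E -> 'cV[R]_m) X : E -> R := fun y => (X y *m w y) 0 0.
Definition endo_app (F : E -> 'M[R]_m) X : vf := fun y => X y *m F y.
Definition bil_app (g : E -> 'M[R]_m) X Y : E -> R :=
  fun y => (X y *m g y *m (Y y)^T) 0 0.

Definition J X : vf := endo_app (cst J0) X.

Definition scale (f : E -> R) X : vf := fun y => f y *: X y.

(* The derivative X f of a scalar function. *)
Definition vf_deriv X (f : E -> R) : E -> R := fun y => 'D_(X y) f y.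

Definition bracket X Y : vf := fun y => 'D_(X y) Y y - 'D_(Y y) X y.

(* 2 dw(X, Y) = X w(Y) - Y w(X) - w([X, Y]) *)
Definition ext_d (w : E -> 'cV[R]_m) X Y : E -> R := fun y =>
  2^-1 * (vf_deriv X (form_app w Y) y - vf_deriv Y (form_app w X) y
          - form_app w (bracket X Y) y).

(* The Levi-Civita connection of the restriction of g to O: the torsion-free   *)
(* metric connection, which is unique as an operator on smooth vector fields.  *)
Record levi_civita O (g : E -> 'M[R]_m) (nabla : vf -> vf -> vf) : Prop := LeviCivita {
  lc_smooth : forall X Y, smooth_on O X -> smooth_on O Y -> smooth_on O (nabla X Y);
  lc_addl : forall X Y Z y, smooth_on O X -> smooth_on O Y -> smooth_on O Z -> O y ->
    nabla (X \+ Y) Z y = nabla X Z y + nabla Y Z y;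
  lc_scalel : forall f X Y y, smooth_on O f -> smooth_on O X -> smooth_on O Y -> O y ->
    nabla (scale f X) Y y = f y *: nabla X Y y;
  lc_addr : forall X Y Z y, smooth_on O X -> smooth_on O Y -> smooth_on O Z -> O y ->
    nabla X (Y \+ Z) y = nabla X Y y + nabla X Z y;
  lc_leibniz : forall f X Y y, smooth_on O f -> smooth_on O X -> smooth_on O Y -> O y ->
    nabla X (scale f Y) y = vf_deriv X f y *: Y y + f y *: nabla X Y y;
  lc_torsion : forall X Y y, smooth_on O X -> smooth_on O Y -> O y ->
    nabla X Y y - nabla Y X y = bracket X Y y;
  lc_metric : forall X Y Z y, smooth_on O X -> smooth_on O Y -> smooth_on O Z -> O y ->
    vf_deriv X (bil_app g Y Z) y = bil_app g (nabla X Y) Z y + bil_app g Y (nabla X Z) y }.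

(* (nabla_X F) Y *)
Definition nabla_endo (nabla : vf -> vf -> vf) (F : E -> 'M[R]_m) X Y : vf :=
  nabla X (endo_app F Y) \- endo_app F (nabla X Y).

Definition nijenhuis (nabla : vf -> vf -> vf) (F : E -> 'M[R]_m) X Y : vf :=
  let f := endo_app F in let DF := nabla_endo nabla F in
  fun y => DF (f X) Y y - DF (f Y) X y - f (DF X Y) y + f (DF Y X) y.

Definition curv (nabla : vf -> vf -> vf) X Y Z : vf := fun y =>
  nabla X (nabla Y Z) y - nabla Y (nabla X Z) y - nabla (bracket X Y) Z y.

Definition curv4 (g : E -> 'M[R]_m) (nabla : vf -> vf -> vf) X Y Z W : E -> R :=
  bil_app g (curv nabla X Y Z) W.

Definition coord_vf (i : 'I_m) : vf := cst (delta_mx 0 i).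

(* ricci(Y, Z) is the trace of X |-> R(X, Y)Z. *)
Definition ricci (nabla : vf -> vf -> vf) Y Z : E -> R := fun y =>
  \sum_i curv nabla (coord_vf i) Y Z y 0 i.

Definition scalar_curv (g : E -> 'M[R]_m) (nabla : vf -> vf -> vf) : E -> R := fun y =>
  \sum_i \sum_j invmx (g y) i j * ricci nabla (coord_vf i) (coord_vf j) y.

(* The complex-valued 1-form u - i v and its exterior derivative. *)
Definition eta (u v : E -> 'cV[R]_m) X : E -> R[i] :=
  fun y => (form_app u X y) +i* (- form_app v X y).
Definition d_eta (u v : E -> 'cV[R]_m) X Y : E -> R[i] :=
  fun y => (ext_d u X Y y) +i* (- ext_d v X Y y).

(* Type (1,0), with holomorphic coefficients eta(d/dz_k) = eta(d/dx_k). *)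
Definition holomorphic_form_on O (w : vf -> E -> R[i]) :=
  (forall X y, O y -> w (J X) y = (0 +i* 1) * w X y) /\
  (forall k : 'I_n, holomorphic_on O (w (coord_vf (lshift n k)))).

(* (eta /\ (d eta)^p)(X_0, ..., X_2p), up to a positive numerical factor that  *)
(* depends on the normalisation of the wedge product.                          *)
Definition eta_wedge_d_eta (p : nat) (u v : E -> 'cV[R]_m)
    (X : 'I_(p.*2.+1) -> vf) : E -> R[i] := fun y =>
  \sum_(s : 'S_(p.*2.+1)) (-1) ^+ s * eta u v (X (s ord0)) y *
    \prod_(i < p) d_eta u v (X (s (inord i.*2.+1))) (X (s (inord i.*2.+2))) y.

End LocalCalculus.

Record chart (R : realType) (n : nat) (M : topologicalType) := Chart {
  dom : set M;
  cod : set 'rV[R]_(n + n);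
  phi : M -> 'rV[R]_(n + n);
  psi : 'rV[R]_(n + n) -> M;
  dom_open : open dom;
  cod_open : open cod;
  phi_cod : forall x, dom x -> cod (phi x);
  psi_dom : forall y, cod y -> dom (psi y);
  phiK : forall x, dom x -> psi (phi x) = x;
  psiK : forall y, cod y -> phi (psi y) = y;
  phi_cont : {within dom, continuous phi};
  psi_cont : {within cod, continuous psi} }.

Definition overlap (R : realType) (n : nat) (M : topologicalType) (a b : chart R n M) :
  set 'rV[R]_(n + n) := cod a `&` psi a @^-1` dom b.

Definition transition (R : realType) (n : nat) (M : topologicalType) (a b : chart R n M) :
  'rV[R]_(n + n) -> 'rV[R]_(n + n) := phi b \o psi a.

Record complexManifold (R : realType) (n : nat) := ComplexManifold {
  carrier :> topologicalType;
  carrier_hausdorff : hausdorff_space carrier;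
  carrier_second_countable : @second_countable carrier;
  atlas : Type;
  chart_of : atlas -> chart R n carrier;
  atlas_cover : forall x : carrier, exists a, dom (chart_of a) x;
  atlas_holomorphic : forall a b,
    holomorphic_map_on (overlap (chart_of a) (chart_of b))
                       (transition (chart_of a) (chart_of b)) }.

Section TensorFields.
Context {R : realType} {n : nat} (N : complexManifold R n).
Local Notation m := (n + n)%N.
Local Notation E := 'rV[R]_m.
Local Notation A := (atlas N).
Local Notation Om a := (cod (chart_of (c:=N) a)).
Local Notation tr a b := (transition (chart_of (c:=N) a) (chart_of (c:=N) b)).
Local Notation ov a b := (overlap (chart_of (c:=N) a) (chart_of (c:=N) b)).

(* A smooth tensor field on N is the family of its smooth components in the    *)
(* charts, transforming by the Jacobians of the transition maps.               *)
Definition is_vector_field (X : A -> E -> E) :=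
  (forall a, smooth_on (Om a) (X a)) /\
  (forall a b y, ov a b y -> X b (tr a b y) = X a y *m 'J (tr a b) y).

Definition is_one_form (w : A -> E -> 'cV[R]_m) :=
  (forall a, smooth_on (Om a) (w a)) /\
  (forall a b y, ov a b y -> w a y = 'J (tr a b) y *m w b (tr a b y)).

Definition is_endo_field (F : A -> E -> 'M[R]_m) :=
  (forall a, smooth_on (Om a) (F a)) /\
  (forall a b y, ov a b y -> F a y *m 'J (tr a b) y = 'J (tr a b) y *m F b (tr a b y)).

Definition is_bilinear_field (g : A -> E -> 'M[R]_m) :=
  (forall a, smooth_on (Om a) (g a)) /\
  (forall a b y, ov a b y ->
     g a y = 'J (tr a b) y *m g b (tr a b y) *m ('J (tr a b) y)^T).

End TensorFields.

Section ContactData.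
Context {R : realType} {p : nat}.
Local Notation m := (p.*2.+1 + p.*2.+1)%N.
Local Notation E := 'rV[R]_m.
Local Notation vf := (E -> E).

(* The data (G, H, J, U, V, u, v, g) on a complex manifold of complex          *)
(* dimension 2p + 1, without normality and without the equations for du and    *)
(* dv; J is J0 in every chart, as the charts are holomorphic. The algebraic    *)
(* identities are between tensors, hence X and Y need not be smooth in them.   *)
Record contactData (N : complexManifold R p.*2.+1) := ContactData {
  metric : atlas N -> E -> 'M[R]_m;
  nabla : atlas N -> vf -> vf -> vf;
  form_u : atlas N -> E -> 'cV[R]_m;
  form_v : atlas N -> E -> 'cV[R]_m;
  field_U : atlas N -> vf;
  field_V : atlas N -> vf;
  endo_G : atlas N -> E -> 'M[R]_m;
  endo_H : atlas N -> E -> 'M[R]_m;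
  metric_tensor : is_bilinear_field metric;
  form_u_tensor : is_one_form form_u;
  form_v_tensor : is_one_form form_v;
  field_U_tensor : is_vector_field field_U;
  field_V_tensor : is_vector_field field_V;
  endo_G_tensor : is_endo_field endo_G;
  endo_H_tensor : is_endo_field endo_H;
  metric_hermitian : forall a y, cod (chart_of a) y ->
    let g := bil_app (metric a) in
    [/\ forall X Y, g X Y y = g Y X y,
        forall X, X y != 0 -> 0 < g X X y &
        forall X Y, g (J X) (J Y) y = g X Y y];
  nabla_levi_civita : forall a, levi_civita (cod (chart_of a)) (metric a) (nabla a);
  eta_holomorphic : forall a,
    holomorphic_form_on (cod (chart_of a)) (eta (form_u a) (form_v a));
  eta_contact : forall a y, cod (chart_of a) y ->
    exists X : 'I_(p.*2.+1) -> vf,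
      (forall i, smooth_on (cod (chart_of a)) (X i)) /\
      eta_wedge_d_eta (form_u a) (form_v a) X y != 0;
  uvUV_axioms : forall a y, cod (chart_of a) y ->
    let g := bil_app (metric a) in
    let u := form_app (form_u a) in let v := form_app (form_v a) in
    let U := field_U a in let V := field_V a in
    [/\ forall X, v X y = u (J X) y,
        V y = - J U y,
        forall X, u X y = g U X y,
        forall X, v X y = g V X y &
        [/\ u U y = 1, v V y = 1, u V y = 0 & v U y = 0]];
  GH_axioms : forall a y, cod (chart_of a) y ->
    let g := bil_app (metric a) in
    let u := form_app (form_u a) in let v := form_app (form_v a) in
    let U := field_U a in let V := field_V a in
    let G := endo_app (endo_G a) in let H := endo_app (endo_H a) in
    [/\ forall X, H X y = G (J X) y,
        forall X, G (G X) y = - X y + u X y *: U y + v X y *: V y,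
        forall X, H (H X) y = - X y + u X y *: U y + v X y *: V y,
        forall X, G (J X) y = - J (G X) y &
        G U y = 0 /\ forall X Y, g X (G Y) y = - g (G X) Y y] }.

End ContactData.

Section Sasakian.
Context {R : realType} {p : nat} {N : complexManifold R p.*2.+1} (D : contactData N).
Local Notation n := p.*2.+1.
Local Notation m := (n + n)%N.
Local Notation E := 'rV[R]_m.
Local Notation vf := (E -> E).
Local Notation Om a := (cod (chart_of (c:=N) a)).
Implicit Types (a : atlas N) (X Y Z W : vf).
Local Notation g a := (bil_app (metric D a)).
Local Notation u a := (form_app (form_u D a)).
Local Notation v a := (form_app (form_v D a)).
Local Notation U a := (field_U D a).
Local Notation V a := (field_V D a).
Local Notation G a := (endo_app (endo_G D a)).
Local Notation H a := (endo_app (endo_H D a)).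

Definition sigma a X : E -> R := g a (nabla D a X (U a)) (V a).

Definition tensor_S a X Y : vf := fun y =>
  nijenhuis (nabla D a) (endo_G D a) X Y y
  + (2 * g a X (G a Y) y) *: U a y - (2 * g a X (H a Y) y) *: V a y
  + 2 *: (v a Y y *: H a X y - v a X y *: H a Y y)
  + sigma a (G a Y) y *: H a X y - sigma a (G a X) y *: H a Y y
  + sigma a X y *: G a (H a Y) y - sigma a Y y *: G a (H a X) y.

Definition tensor_T a X Y : vf := fun y =>
  nijenhuis (nabla D a) (endo_H D a) X Y y
  - (2 * g a X (G a Y) y) *: U a y + (2 * g a X (H a Y) y) *: V a y
  + 2 *: (u a Y y *: G a X y - u a X y *: G a Y y)
  + sigma a (H a X) y *: G a Y y - sigma a (H a Y) y *: G a X y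
  + sigma a X y *: G a (H a Y) y - sigma a Y y *: G a (H a X) y.

Definition horizontal a X := forall y, Om a y -> u a X y = 0 /\ v a X y = 0.

Definition normal_structure := forall a,
  (forall X Y, smooth_on (Om a) X -> smooth_on (Om a) Y ->
     horizontal a X -> horizontal a Y ->
     forall y, Om a y -> tensor_S a X Y y = 0 /\ tensor_T a X Y y = 0) /\
  (forall X, smooth_on (Om a) X ->
     forall y, Om a y -> tensor_S a X (U a) y = 0 /\ tensor_T a X (V a) y = 0).

Definition complex_sasakian :=
  normal_structure /\
  forall a X Y, smooth_on (Om a) X -> smooth_on (Om a) Y -> forall y, Om a y ->
    g a X (G a Y) y = ext_d (form_u D a) X Y y /\
    g a X (H a Y) y = ext_d (form_v D a) X Y y.

Definition tensor_B (c : 'I_11 -> N -> R) a X Y Z W : E -> R := fun y =>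
  let A k := c (inord k) (psi (chart_of a) y) in
  let Rm X Y Z W := curv4 (metric D a) (nabla D a) X Y Z W y in
  let rho X Y := ricci (nabla D a) X Y y in
  let tau := scalar_curv (metric D a) (nabla D a) y in
  let g X Y := g a X Y y in
  A 0%N * Rm X Y Z W + A 1%N * Rm X Z Y W
  + A 2%N * (rho Y Z * g X W) + A 3%N * (rho X Z * g Y W)
  + A 4%N * (rho X Y * g Z W) + A 5%N * (rho X W * g Y Z)
  + A 6%N * (rho Y W * g X Z) + A 7%N * (rho Z W * g X Y)
  + tau * (A 8%N * (g X W * g Y Z) + A 9%N * (g X Z * g Y W) + A 10%N * (g X Y * g Z W)).

Definition B_flat (c : 'I_11 -> N -> R) :=
  forall a X Y Z W, smooth_on (Om a) X -> smooth_on (Om a) Y ->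
    smooth_on (Om a) Z -> smooth_on (Om a) W ->
    forall y, Om a y -> tensor_B c a X Y Z W y = 0.

End Sasakian.

(* Main.v *)
Require Import Defs.
From mathcomp Require Import all_boot all_order all_algebra.
From mathcomp Require Import all_classical all_reals all_analysis.
From mathcomp Require Import zify ring lra.

(** Everything is done at a point of a chart, with constant coordinate fields.
    Normality together with [du = G~] and [dv = H~] forces [sigma = 0],
    [nabla_X U = - G X], [nabla_X V = - H X] and explicit formulas for
    [nabla G] and [nabla H]. Differentiating once more gives [R(X, Y)U] and
    [R(X, Y)V] explicitly, as well as the commutators of [R(X, Y)] with [G] and
    [H] on horizontal vectors; traces of the latter and the Bianchi identity
    yield [rho = - 4 g] on horizontal vectors, while [rho(U, U) = rho(V, V) = 4p],
    so that [tau = - 8p]. Let [B] vanish at a point and let [e] be horizontal.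
    The values of [B] at [(e, Je, U, V)] and [(e, U, Je, V)], where no metric or
    Ricci term survives and [R] is [- 2 |e|^2] and [- |e|^2], give
    [a_0 = a_1 = 0]. The values on the orthogonal pairs [(U, V)], [(U, e)] and
    [(e, U)] then kill the other coefficients, because [4p <> - 4] and
    [tau <> 0]. *)

Set Implicit Arguments.
Unset Strict Implicit.
Unset Printing Implicit Defensive.
Import Order.TTheory GRing.Theory Num.Theory.
Import numFieldNormedType.Exports.
Local Open Scope classical_set_scope.
Local Open Scope ring_scope.

(** * Smooth functions *)

(** The constant in $\rho=-4g$ comes from two traces. On horizontal vectors $G$ is, up to sign, the
    product of the anticommuting $H$ and $K=HG$, so tracing $[H,R(x,z)]$ against $K$ gives
    $\mathrm{tr}(G R(x,z))=-2h\,g(Gx,z)$, where $h=4p$ is the horizontal dimension. By the Bianchi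
    identity half of this is the trace of $z\mapsto G R(x,z)y$ (with $y$ for $z$ on the left). The
    formula for $[G,R(x,z)]y$, now traced over $z$, compares it with the trace of $z\mapsto
    R(x,z)Gy$, the difference being $(h-4)g(Gx,y)$. The dimension cancels and a universal constant
    remains. The obstacle is that the commutators are known on horizontal vectors only, so each
    trace comparison must account for the two vertical diagonal entries.

    The work is halved by the symmetry $(G,H,U,V)\mapsto(H,-G,V,-U)$, which turns $S$ into $T$: each
    statement on $U$ and $G$ is proved once and read a second time for $V$ and $H$. All tensor
    computations take place in records of matrices at one point; analysis serves only to fill these
    records. *)

Section Differentiability.
Context {R : realType} {V : normedModType R}.

Lemma differentiable_mxP (m n : nat) (M : V -> 'M[R]_(m, n)) y :
  differentiable M y <-> forall i j, differentiable (fun z => M z i j : R) y.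
Proof.
split=> [dM i j|dM].
  exact: (differentiable_comp dM (differentiable_coord _ i j)).
have -> : M = (\sum_i \sum_j (fun z => M z i j *: delta_mx i j)).
  apply/funext => z; rewrite {1}[M z]matrix_sum_delta fct_sumE.
  by apply: eq_bigr => i _; rewrite fct_sumE.
apply: differentiable_sum => i; apply: differentiable_sum => j.
exact: differentiableZl.
Qed.

Lemma derive_mx_entry (m n : nat) (M : V -> 'M[R]_(m, n)) y w i j :
  differentiable M y -> ('D_w M y) i j = 'D_w (fun z => M z i j : R) y.
Proof. by move=> dM; rewrite derive_mx ?mxE //; apply: diff_derivable. Qed.

(** Linear and bilinear operations enter only through their derivative rule, so that one induction
    on the order of differentiability serves transposes, entries, products and scalings alike. *)
Definition derive_linear (T T' : normedModType R) (l : T -> T') :=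
  forall (f : V -> T) y, differentiable f y ->
    differentiable (fun z => l (f z)) y /\
    forall w, 'D_w (fun z => l (f z)) y = l ('D_w f y).

Definition derive_bilinear (T1 T2 T3 : normedModType R) (b : T1 -> T2 -> T3) :=
  forall (f : V -> T1) (h : V -> T2) y, differentiable f y -> differentiable h y ->
    differentiable (fun z => b (f z) (h z)) y /\
    forall w, 'D_w (fun z => b (f z) (h z)) y = b ('D_w f y) (h y) + b (f y) ('D_w h y).

Lemma derive_linear_trmx (m n : nat) :
  derive_linear (fun A : 'M[R]_(m, n) => A^T).
Proof.
move=> f y df.
have E i j : (fun z => (f z)^T i j) = (fun z => f z j i) by apply/funext => z; rewrite mxE.
have dt : differentiable (fun z => (f z)^T) y.
  by apply/differentiable_mxP => i j; rewrite E; move/differentiable_mxP: df; apply.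
by split=> // w; apply/matrixP => i j; rewrite derive_mx_entry // mxE derive_mx_entry // E.
Qed.

Lemma derive_linear_entry (m n : nat) i j :
  derive_linear (fun A : 'M[R]_(m, n) => A i j : R).
Proof.
by move=> f y df; split=> [|w]; [move/differentiable_mxP: df; apply|rewrite derive_mx_entry].
Qed.

Lemma derive_linear_opp (T : normedModType R) : derive_linear (fun A : T => - A).
Proof.
move=> f y df; split=> [|w]; first exact: differentiableN.
by rewrite deriveN //; apply: diff_derivable.
Qed.

Lemma derive_bilinear_mul : derive_bilinear (fun k l : R => k * l).
Proof.
move=> f h y df dh; split=> [|w]; first exact: differentiableM.
rewrite deriveM; [|exact: diff_derivable..].
by rewrite addrC mulrC -![_ *: _]/(_ * _).
Qed.

Lemma derive_bilinear_scale (m n : nat) :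
  derive_bilinear (fun (k : R) (A : 'M[R]_(m, n)) => k *: A).
Proof.
move=> f h y df /[dup] dh /differentiable_mxP dh'.
have E i j : (fun z => (f z *: h z) i j) = (fun z => f z * h z i j).
  by apply/funext => z; rewrite mxE.
have dd : differentiable (fun z => f z *: h z) y.
  apply/differentiable_mxP => i j; rewrite E.
  by have [] := derive_bilinear_mul df (dh' i j).
split=> // w; apply/matrixP => i j; rewrite derive_mx_entry // E.
by have [_ ->] := derive_bilinear_mul df (dh' i j); rewrite !mxE derive_mx_entry.
Qed.

Lemma derive_bilinear_mulmx (m n k : nat) :
  derive_bilinear (fun (A : 'M[R]_(m, n)) (B : 'M[R]_(n, k)) => A *m B).
Proof.
move=> f h y /[dup] df /differentiable_mxP df' /[dup] dh /differentiable_mxP dh'.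
have E i j : (fun z => (f z *m h z) i j) = \sum_l (fun z => f z i l * h z l j).
  by apply/funext => z; rewrite mxE fct_sumE.
have dm i j l : differentiable (fun z => f z i l * h z l j) y.
  by have [] := derive_bilinear_mul (df' i l) (dh' l j).
have dd : differentiable (fun z => f z *m h z) y.
  by apply/differentiable_mxP => i j; rewrite E; apply: differentiable_sum.
split=> // w; apply/matrixP => i j; rewrite derive_mx_entry // E derive_sum; last first.
  by move=> l; apply: diff_derivable.
rewrite !mxE -big_split; apply: eq_bigr => l _ /=.
by have [_ ->] := derive_bilinear_mul (df' i l) (dh' l j); rewrite !derive_mx_entry.
Qed.
End Differentiability.

(** Fields are controlled only on the open image of a chart. Applied to the difference of two
    functions that agree there, this transfers differentiability from one to the other. *)
Lemma differentiable_near0 {R : realType} (V W : normedModType R) (k : V -> W) x :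
  (\forall z \near x, k z = 0) -> differentiable k x.
Proof.
move=> k0.
have dk : k \o shift x = cst (k x) + \0 +o_ 0 id.
  apply/eqaddoP => _/posnumP[e].
  have := k0; rewrite (near_shift 0 x) /= subr0 => k0'.
  near=> h; rewrite /= -![(_ + _ : _ -> _) _]/(_ + _) -![(- _ : _ -> _) _]/(- _) /=.
  rewrite /cst (nbhs_singleton k0) addr0 subr0.
  have -> : k (h + x) = 0 by near: h.
  by rewrite normr0 mulr_ge0.
apply/diff_locallyP; rewrite (diff_unique (df := \0) _ dk); last exact: cst_continuous.
by split=> //; exact: cst_continuous.
Unshelve. all: by end_near. Qed.

(** * Mean values along segments and the symmetry of second derivatives *)

Section MeanValue.
Context {R : realType} {V : normedModType R}.
Implicit Types (f : V -> R) (p x z : V).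

Lemma MVT_line f p x (t : R) : 0 < t ->
  (forall s, s \in `[0, t] -> differentiable f (p + s *: x)) ->
  exists2 c, c \in `]0, t[ & f (p + t *: x) - f p = t * 'D_x f (p + c *: x).
Proof.
move=> t0 df.
pose l := fun s : R => p + s *: x.
have dl s : differentiable l s by apply: differentiableD => //; exact: differentiableZl.
have dfl s : s \in `[0, t] -> differentiable (f \o l) s.
  by move=> st; apply: differentiable_comp => //; exact: df.
have Dfl s : s \in `[0, t] -> is_derive s 1 (f \o l) ('D_x f (l s)).
  move=> st; apply: DeriveDef; first exact/diff_derivable/dfl.
  rewrite deriveE; last exact: dfl.
  have -> /= : ('d (f \o l) s 1 = 'd f (l s) ('d l s 1)) by rewrite diff_comp //; exact: df.
  have -> : 'd l s 1 = x; last by rewrite -deriveE //; exact: df.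
  rewrite -deriveE; last exact: dl.
  rewrite /derive; apply: cvg_lim => //=.
  apply: (@cvg_trans _ ((fun=> x) @ (0:R)^')); last exact: cvg_cst.
  apply: near_eq_cvg; near=> h.
  rewrite [h%:A]mulr1 /l opprD addrACA subrr add0r -scalerBl addrK scalerA mulVf ?scale1r //.
  by near: h; exact: nbhs_dnbhs_neq.
have D01 s : s \in `]0, t[ -> is_derive s 1 (f \o l) ('D_x f (l s)).
  by rewrite in_itv /= => /andP[? ?]; apply: Dfl; rewrite in_itv /= !ltW.
have cont : {within `[0, t], continuous (f \o l)}.
  apply: continuous_in_subspaceT => s; rewrite inE /= => st.
  by apply: differentiable_continuous; apply: dfl.
have [c ct] := MVT t0 D01 cont.
by rewrite /l /= scale0r addr0 subr0 mulrC => fE; exists c.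
Unshelve. all: by end_near. Qed.

End MeanValue.

Lemma ler_dist_half {R : realFieldType} (e p q r : R) :
  `|p - r| < e / 2 -> `|q - r| < e / 2 -> `|p - q| <= e.
Proof. by rewrite !ltr_norml ler_norml => /andP[? ?] /andP[? ?]; apply/andP; split; lra. Qed.

Section Smooth.
Context {R : realType} {n : nat}.
Local Notation E := 'rV[R]_(n + n).
Variable O : set E.
Hypothesis O_open : open O.
Implicit Types x z w y : E.

Lemma near_on (P : E -> Prop) y : O y -> (forall z, O z -> P z) -> \forall z \near y, P z.
Proof.
move=> Oy OP; have : nbhs y O by exact: open_nbhs_nbhs.
by apply: filterS OP.
Qed.

Lemma smooth_differentiable (T : normedModType R) (f : E -> T) y :
  smooth_on O f -> O y -> differentiable f y.
Proof. by move=> sf; exact: (sf [::]). Qed.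

Lemma smooth_derive (T : normedModType R) (f : E -> T) w :
  smooth_on O f -> smooth_on O ('D_w f).
Proof. by move=> sf s y Oy; have := sf (rcons s w) y Oy; rewrite foldr_rcons. Qed.

Lemma derive_translate (f : E -> R) (c p w : E) :
  'D_w (fun q => f (q + c)) p = 'D_w f (p + c).
Proof.
rewrite /derive.
have -> : (fun h : R => h^-1 *: (((fun q => f (q + c)) \o shift p) (h *: w) - f (p + c))) =
  (fun h : R => h^-1 *: ((f \o shift (p + c)) (h *: w) - f (p + c))); last by [].
by apply/funext => h; rewrite /= addrA.
Qed.

(** Two mean value arguments: along [x] for the increment $q\mapsto f(q+tz)-f(q)$, then along [z]
    for the derivative of [f] in direction [x]. *)
Lemma second_difference (f : E -> R) y x z (t : R) : smooth_on O f -> 0 < t ->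
  (forall a b, a \in `[0, t] -> b \in `[0, t] -> O (y + a *: x + b *: z)) ->
  exists a b, [/\ a \in `[0, t], b \in `[0, t] &
    f (y + t *: x + t *: z) - f (y + t *: x) - f (y + t *: z) + f y =
    t * (t * 'D_z ('D_x f) (y + a *: x + b *: z))].
Proof.
move=> sf t0 Ot.
have I0 : 0 \in `[0, t] by rewrite in_itv /= lexx ltW.
have It : t \in `[0, t] by rewrite in_itv /= lexx ltW.
pose h := fun q => f (q + t *: z) - f q.
have dsh (q : E) : differentiable f (q + t *: z) -> differentiable (fun q => f (q + t *: z)) q.
  move=> df; apply: (@differentiable_comp _ _ _ _ (fun q : E => q + t *: z)) => //.
have Ot0 a : a \in `[0, t] -> O (y + a *: x).
  by move=> /Ot/(_ I0); rewrite scale0r addr0.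
have dh a : a \in `[0, t] -> differentiable h (y + a *: x).
  move=> aI; apply: differentiableB; first by apply/dsh/smooth_differentiable => //; exact: Ot.
  by apply: smooth_differentiable => //; exact: Ot0.
have [a aI hE] := MVT_line t0 dh.
have {}aI : a \in `[0, t] by apply: subset_itvW aI.
have DhE : 'D_x h (y + a *: x) = 'D_x f (y + a *: x + t *: z) - 'D_x f (y + a *: x).
  rewrite deriveB; first last.
  - by apply/diff_derivable/smooth_differentiable => //; exact: Ot0.
  - by apply/diff_derivable/dsh/smooth_differentiable => //; exact: Ot.
  by rewrite derive_translate.
have dDf b : b \in `[0, t] -> differentiable ('D_x f) (y + a *: x + b *: z).
  by move=> bI; apply: smooth_differentiable; [exact: smooth_derive|exact: Ot].
have [b bI DE] := MVT_line t0 dDf.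
exists a, b; split=> //; first by apply: subset_itvW bI.
by rewrite -DE -DhE -hE /h addrAC; ring.
Qed.

(** Schwarz's theorem. The second difference is symmetric in [x] and [z], so the two mixed
    derivatives agree when taken at two suitable points of a small parallelogram; continuity brings
    both points back to [y]. *)
Lemma derive_comm_scalar (f : E -> R) y x z : smooth_on O f -> O y ->
  'D_x ('D_z f) y = 'D_z ('D_x f) y.
Proof.
move=> sf Oy; apply/eqP; rewrite -subr_eq0 -normr_le0; apply/ler_addgt0Pl => e e0.
rewrite addr0.
have cont v w : \forall q \near y, `|'D_v ('D_w f) y - 'D_v ('D_w f) q| < e / 2.
  have /differentiable_continuous/cvgrPdist_lt : differentiable ('D_v ('D_w f)) y.
    by apply: smooth_differentiable => //; do 2 apply: smooth_derive.
  by apply; rewrite divr_gt0.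
have /nbhs_ballP[d d0 dP] : \forall q \near y, [/\ O q,
    `|'D_x ('D_z f) y - 'D_x ('D_z f) q| < e / 2 & `|'D_z ('D_x f) y - 'D_z ('D_x f) q| < e / 2].
  have nO : \forall q \near y, O q by exact: open_nbhs_nbhs.
  have c1 := cont x z; have c2 := cont z x.
  by apply: filterS3 nO c1 c2 => q Oq q1 q2; split.
(* Keeps the whole parallelogram with sides $tx$, $tz$ inside the ball of radius [d]; the summand 1
   covers the case $x=z=0$. *)
pose t := d / (2 * (`|x| + `|z| + 1)).
have c0 : 0 < `|x| + `|z| + 1 by rewrite ltr_wpDl // addr_ge0.
have t0 : 0 < t by rewrite divr_gt0 ?mulr_gt0.
have td : t * (`|x| + `|z|) < d.
  have : t * (`|x| + `|z| + 1) = d / 2 by rewrite /t; field; rewrite gt_eqF.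
  by move: (t0) (d0) => /=; lra.
have inb a b : a \in `[0, t] -> b \in `[0, t] -> ball y d (y + a *: x + b *: z).
  rewrite !in_itv /= => /andP[a0 at_] /andP[b0 bt].
  rewrite -ball_normE /= -addrA opprD addrA subrr add0r normrN.
  apply: le_lt_trans td; rewrite mulrDr (le_trans (ler_normD _ _)) // !normrZ.
  by rewrite !ger0_norm // lerD // ler_wpM2r.
have [a [b [aI bI E1]]] := @second_difference f y x z t sf t0
  (fun a b aI bI => let: And3 Oq _ _ := dP _ (inb a b aI bI) in Oq).
have [a' [b' [aI' bI' E2]]] := @second_difference f y z x t sf t0
  (fun a b aI bI => let: And3 Oq _ _ := dP _ (eq_rect _ (ball y d) (inb b a bI aI) _ (addrAC _ _ _)) in Oq).
have canc (p q : R) : t * (t * p) = t * (t * q) -> p = q.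
  by move=> /(mulfI (lt0r_neq0 t0)) /(mulfI (lt0r_neq0 t0)).
have FE : f (y + t *: z + t *: x) - f (y + t *: z) - f (y + t *: x) + f y =
  f (y + t *: x + t *: z) - f (y + t *: x) - f (y + t *: z) + f y.
  by rewrite [y + t *: z + t *: x]addrAC; ring.
have [_ _ D1] := dP _ (inb a b aI bI).
have [_ D2 _] := dP _ (inb b' a' bI' aI').
rewrite FE E1 in E2; move/canc: E2; rewrite [in RHS]addrAC => E12.
by rewrite E12 in D1; exact: ler_dist_half D2 D1.
Qed.

Lemma differentiable_eq_on (T : normedModType R) (f h : E -> T) y :
  (forall q, O q -> f q = h q) -> O y -> differentiable f y -> differentiable h y.
Proof.
move=> fh Oy df; have -> : h = f + (h - f) by rewrite addrC subrK.
apply: differentiableD => //; apply: differentiable_near0; apply: near_on => // q Oq.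
by rewrite -![(_ + _ : _ -> _) _]/(_ + _) -![(- _ : _ -> _) _]/(- _) fh // subrr.
Qed.

Lemma derive_eq_on (T : normedModType R) (f h : E -> T) y w :
  (forall q, O q -> f q = h q) -> O y -> 'D_w f y = 'D_w h y.
Proof. by move=> fh Oy; apply: near_eq_derive; exact: near_on. Qed.

(** A recursive counterpart of [smooth_on]. The derivative of a product is a sum of products, each
    with one factor differentiated, so closure properties follow by induction on [k], which the
    lists of directions in [smooth_on] do not offer directly. *)
Fixpoint Ck (k : nat) (T : normedModType R) (f : E -> T) : Prop :=
  if k is k'.+1 then (forall y, O y -> differentiable f y) /\ forall w, Ck k' ('D_w f)
  else True.

Lemma smooth_onE (T : normedModType R) (f : E -> T) :
  smooth_on O f <-> forall k, Ck k f.
Proof.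
split=> [sf k|Cf s].
  elim: k f sf => [|k IH] f sf //; split; first exact: (sf [::]).
  by move=> w; apply: IH; exact: smooth_derive.
elim/last_ind: s f Cf => [|s w IH] f Cf; first exact: (Cf 1%N).1.
by rewrite foldr_rcons; apply: IH => k; exact: (Cf k.+1).2.
Qed.

Lemma CkW k (T : normedModType R) (f : E -> T) : Ck k.+1 f -> Ck k f.
Proof. by elim: k f => [|k IH] f // [df Df]; split=> // w; exact: IH. Qed.

Lemma Ck_eq_on k (T : normedModType R) (f h : E -> T) :
  (forall q, O q -> f q = h q) -> Ck k f -> Ck k h.
Proof.
elim: k f h => [|k IH] f h fh // [df Df]; split=> [y Oy|w].
  exact: differentiable_eq_on fh Oy (df y Oy).
by apply: IH (Df w) => q Oq; exact: derive_eq_on.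
Qed.

Lemma Ck_add k (T : normedModType R) (f h : E -> T) :
  Ck k f -> Ck k h -> Ck k (fun y => f y + h y).
Proof.
elim: k f h => [|k IH] f h // [df Df] [dh Dh]; split=> [y Oy|w].
  by apply: differentiableD; [exact: df|exact: dh].
apply: Ck_eq_on (IH _ _ (Df w) (Dh w)) => q Oq.
by rewrite deriveD //; apply: diff_derivable; [exact: df|exact: dh].
Qed.

Lemma Ck_linear k (T T' : normedModType R) (l : T -> T') (f : E -> T) :
  derive_linear (V := E) l -> Ck k f -> Ck k (fun y => l (f y)).
Proof.
move=> lP; elim: k f => [|k IH] f // [df Df]; split=> [y Oy|w].
  by have [] := lP f y (df y Oy).
by apply: Ck_eq_on (IH _ (Df w)) => q Oq; have [_ ->] := lP f q (df q Oq).
Qed.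

Lemma Ck_bilinear k (T1 T2 T3 : normedModType R) (b : T1 -> T2 -> T3) (f : E -> T1) (h : E -> T2) :
  derive_bilinear (V := E) b -> Ck k f -> Ck k h -> Ck k (fun y => b (f y) (h y)).
Proof.
move=> bP; elim: k f h => [|k IH] f h // Cf Ch; split=> [y Oy|w].
  by have [] := bP f h y (Cf.1 y Oy) (Ch.1 y Oy).
apply: Ck_eq_on (Ck_add (IH _ _ (Cf.2 w) (CkW Ch)) (IH _ _ (CkW Cf) (Ch.2 w))) => q Oq.
by have [_ ->] := bP f h q (Cf.1 q Oq) (Ch.1 q Oq).
Qed.

Lemma smooth_cst (T : normedModType R) (c : T) : smooth_on O (cst c : E -> T).
Proof.
move=> s y _.
suff [c' ->] : exists c', foldr (fun w (h : E -> T) => 'D_w h) (cst c) s = cst c'.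
  exact: differentiable_cst.
elim: s => [|w s [c' IH]] /=; first by exists c.
by exists 0; apply/funext => q; rewrite IH derive_cst.
Qed.

Lemma smooth_add (T : normedModType R) (f h : E -> T) :
  smooth_on O f -> smooth_on O h -> smooth_on O (fun y => f y + h y).
Proof.
by move=> /smooth_onE sf /smooth_onE sh; apply/smooth_onE => k; exact: Ck_add.
Qed.

Lemma smooth_linear (T T' : normedModType R) (l : T -> T') (f : E -> T) :
  derive_linear (V := E) l -> smooth_on O f -> smooth_on O (fun y => l (f y)).
Proof. by move=> lP /smooth_onE sf; apply/smooth_onE => k; exact: Ck_linear. Qed.

Lemma smooth_bilinear (T1 T2 T3 : normedModType R) (b : T1 -> T2 -> T3) (f : E -> T1) (h : E -> T2) :
  derive_bilinear (V := E) b -> smooth_on O f -> smooth_on O h -> smooth_on O (fun y => b (f y) (h y)).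
Proof.
by move=> bP /smooth_onE sf /smooth_onE sh; apply/smooth_onE => k; exact: Ck_bilinear.
Qed.

Lemma smooth_mulmx (m k l : nat) (A : E -> 'M[R]_(m, k)) (B : E -> 'M[R]_(k, l)) :
  smooth_on O A -> smooth_on O B -> smooth_on O (fun y => A y *m B y).
Proof. by move=> sA sB; exact: (smooth_bilinear (@derive_bilinear_mulmx R _ m k l) sA sB). Qed.

Lemma smooth_scale (m k : nat) (f : E -> R) (A : E -> 'M[R]_(m, k)) :
  smooth_on O f -> smooth_on O A -> smooth_on O (fun y => f y *: A y).
Proof. by move=> sf sA; exact: (smooth_bilinear (@derive_bilinear_scale R _ m k) sf sA). Qed.

Lemma smooth_trmx (m k : nat) (A : E -> 'M[R]_(m, k)) :
  smooth_on O A -> smooth_on O (fun y => (A y)^T).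
Proof. by move=> sA; exact: (smooth_linear (@derive_linear_trmx R _ m k) sA). Qed.

Lemma smooth_entry (m k : nat) (A : E -> 'M[R]_(m, k)) i j :
  smooth_on O A -> smooth_on O (fun y => A y i j : R).
Proof. by move=> sA; exact: (smooth_linear (@derive_linear_entry R _ m k i j) sA). Qed.

Lemma smooth_opp (T : normedModType R) (f : E -> T) :
  smooth_on O f -> smooth_on O (fun y => - f y).
Proof. by move=> sf; exact: (smooth_linear (@derive_linear_opp R _ T) sf). Qed.

Lemma smooth_sum (T : normedModType R) (I : finType) (f : I -> E -> T) :
  (forall i, smooth_on O (f i)) -> smooth_on O (fun y => \sum_i f i y).
Proof.
move=> sf; rewrite -[X in smooth_on O X]fct_sumE.
elim/big_ind: _ => // [|F H sF sH]; [exact: smooth_cst|exact: smooth_add].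
Qed.

Lemma smooth_matrix (m k : nat) (A : E -> 'M[R]_(m, k)) :
  (forall i j, smooth_on O (fun y => A y i j : R)) -> smooth_on O A.
Proof.
move=> sA; have -> : A = (fun y => \sum_i \sum_j A y i j *: delta_mx i j).
  by apply/funext => y; exact: matrix_sum_delta.
apply: smooth_sum => i; apply: smooth_sum => j; apply: smooth_scale => //; exact: smooth_cst.
Qed.

Lemma derive_comm (m k : nat) (A : E -> 'M[R]_(m, k)) y x z : smooth_on O A -> O y ->
  'D_x ('D_z A) y = 'D_z ('D_x A) y.
Proof.
move=> sA Oy; apply/matrixP => i j.
have D w w' : ('D_w ('D_w' A) y) i j = 'D_w ('D_w' (fun q => A q i j : R)) y.
  rewrite derive_mx_entry; last by apply: smooth_differentiable => //; exact: smooth_derive.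
  by apply: derive_eq_on => // q Oq; rewrite derive_mx_entry //; exact: smooth_differentiable.
apply: etrans (D x z) _; apply: etrans (esym (D z x)).
exact: (derive_comm_scalar x z (smooth_entry i j sA) Oy).
Qed.

Section Rules.
Variables (y : E) (Oy : O y) (w : E).

Lemma derive_mulmx (m k l : nat) (A : E -> 'M[R]_(m, k)) (B : E -> 'M[R]_(k, l)) :
  smooth_on O A -> smooth_on O B ->
  'D_w (fun q => A q *m B q) y = 'D_w A y *m B y + A y *m 'D_w B y.
Proof.
by move=> sA sB; have [_ ->] := derive_bilinear_mulmx
  (smooth_differentiable sA Oy) (smooth_differentiable sB Oy).
Qed.

Lemma derive_scale (m k : nat) (f : E -> R) (A : E -> 'M[R]_(m, k)) :
  smooth_on O f -> smooth_on O A ->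
  'D_w (fun q => f q *: A q) y = 'D_w f y *: A y + f y *: 'D_w A y.
Proof.
by move=> sA sB; have [_ ->] := derive_bilinear_scale
  (smooth_differentiable sA Oy) (smooth_differentiable sB Oy).
Qed.

Lemma derive_add (T : normedModType R) (f h : E -> T) :
  smooth_on O f -> smooth_on O h -> 'D_w (fun q => f q + h q) y = 'D_w f y + 'D_w h y.
Proof.
by move=> sf sh; rewrite deriveD //; apply: diff_derivable; exact: smooth_differentiable.
Qed.

Lemma derive_opp (T : normedModType R) (f : E -> T) :
  smooth_on O f -> 'D_w (fun q => - f q) y = - 'D_w f y.
Proof. by move=> sf; rewrite deriveN //; apply: diff_derivable; exact: smooth_differentiable. Qed.

Lemma derive_trmx (m k : nat) (A : E -> 'M[R]_(m, k)) :
  smooth_on O A -> 'D_w (fun q => (A q)^T) y = ('D_w A y)^T.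
Proof. by move=> sA; have [_ ->] := derive_linear_trmx (smooth_differentiable sA Oy). Qed.

Lemma derive_entry (m k : nat) (A : E -> 'M[R]_(m, k)) i j :
  smooth_on O A -> 'D_w (fun q => A q i j : R) y = 'D_w A y i j.
Proof. by move=> sA; have [_ ->] := derive_linear_entry i j (smooth_differentiable sA Oy). Qed.

Lemma derive_const (T : normedModType R) (c : T) : 'D_w (fun=> c : T) y = 0.
Proof. exact: derive_cst. Qed.

Lemma derive_dirD (T : normedModType R) (f : E -> T) x z : smooth_on O f ->
  'D_(x + z) f y = 'D_x f y + 'D_z f y.
Proof. by move=> /smooth_differentiable/(_ Oy) df; rewrite !deriveE // linearD. Qed.

Lemma derive_dirZ (T : normedModType R) (f : E -> T) k x : smooth_on O f ->
  'D_(k *: x) f y = k *: 'D_x f y.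
Proof. by move=> /smooth_differentiable/(_ Oy) df; rewrite !deriveE // linearZ. Qed.
End Rules.
End Smooth.

(** * The Levi-Civita connection in a chart *)

Lemma form_delta {R : realType} (m : nat) (A : 'M[R]_m) i j :
  ((delta_mx 0 i : 'rV_m) *m A *m (delta_mx 0 j : 'rV_m)^T) 0 0 = A i j.
Proof. by rewrite trmx_delta -rowE -colE !mxE. Qed.

Section Christoffel.
Context {R : realType} {n : nat}.
Local Notation m := (n + n)%N.
Local Notation E := 'rV[R]_m.
Local Notation vf := (E -> E).
Variables (O : set E) (g : E -> 'M[R]_m) (nabla : vf -> vf -> vf).
Hypotheses (O_open : open O) (lc : levi_civita O g nabla) (g_smooth : smooth_on O g).
Implicit Types (x z w y : E) (X Y Z W : vf).

(** The Christoffel symbols contracted with the direction [x], arranged so that the connection reads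
    $D_xY+Y\,\Gamma_x$ on row vectors. *)
Definition Gam x y : 'M[R]_m := \matrix_i nabla (cst x) (coord_vf i) y.

Lemma nabla_suml (I : Type) (r : seq I) (f : I -> E -> R) (X : I -> vf) Y y :
  (forall i, smooth_on O (f i)) -> (forall i, smooth_on O (X i)) -> smooth_on O Y -> O y ->
  nabla (fun q => \sum_(i <- r) f i q *: X i q) Y y = \sum_(i <- r) f i y *: nabla (X i) Y y.
Proof.
move=> sf sX sY Oy; elim: r => [|i r IH].
  rewrite big_nil; have -> : (fun q => \sum_(i <- [::]) f i q *: X i q) = scale (cst 0) Y.
    by apply/funext => q; rewrite big_nil /scale scale0r.
  by rewrite (lc_scalel lc) ?scale0r //; exact: smooth_cst.
have sfX j : smooth_on O (scale (f j) (X j)) by exact: smooth_scale.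
rewrite big_cons -IH.
have -> : (fun q => \sum_(j <- i :: r) f j q *: X j q) =
    scale (f i) (X i) \+ (fun q => \sum_(j <- r) f j q *: X j q).
  by apply/funext => q; rewrite big_cons.
rewrite (lc_addl lc) ?(lc_scalel lc) //.
elim: r {IH} => [|j r IH].
  under eq_fun do rewrite big_nil.
  exact: smooth_cst.
under eq_fun do rewrite big_cons.
exact: (smooth_add O_open (sfX j) IH).
Qed.

Lemma nabla_sumr (I : Type) (r : seq I) (f : I -> E -> R) X (Y : I -> vf) y :
  (forall i, smooth_on O (f i)) -> (forall i, smooth_on O (Y i)) -> smooth_on O X -> O y ->
  nabla X (fun q => \sum_(i <- r) f i q *: Y i q) y =
  \sum_(i <- r) (vf_deriv X (f i) y *: Y i y + f i y *: nabla X (Y i) y).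
Proof.
move=> sf sY sX Oy; elim: r => [|i r IH].
  rewrite big_nil; have -> : (fun q => \sum_(i <- [::]) f i q *: Y i q) = scale (cst 0) X.
    by apply/funext => q; rewrite big_nil /scale scale0r.
  rewrite (lc_leibniz lc) //; last exact: smooth_cst.
  by rewrite /vf_deriv derive_cst !scale0r addr0.
have sfY j : smooth_on O (scale (f j) (Y j)) by exact: smooth_scale.
rewrite big_cons -IH.
have -> : (fun q => \sum_(j <- i :: r) f j q *: Y j q) =
    scale (f i) (Y i) \+ (fun q => \sum_(j <- r) f j q *: Y j q).
  by apply/funext => q; rewrite big_cons.
rewrite (lc_addr lc) ?(lc_leibniz lc) //.
elim: r {IH} => [|j r IH].
  under eq_fun do rewrite big_nil.
  exact: smooth_cst.
under eq_fun do rewrite big_cons.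
exact: (smooth_add O_open (sfY j) IH).
Qed.

Lemma sum_coord X : X = (fun q => \sum_i X q 0 i *: coord_vf i q).
Proof. by apply/funext => q; rewrite [LHS]row_sum_delta. Qed.

(** Tensoriality in the differentiating field; the coordinate frame exists on the whole chart, so
    finite expansions suffice and no cut-off functions occur. *)
Lemma nabla_pointwise X Y y : smooth_on O X -> smooth_on O Y -> O y ->
  nabla X Y y = nabla (cst (X y)) Y y.
Proof.
move=> sX sY Oy; rewrite (sum_coord X) (sum_coord (cst _)).
rewrite !nabla_suml //; try (by move=> i; exact: smooth_cst).
  by apply: eq_bigr => i _; rewrite /cst -row_sum_delta.
by move=> i; exact: smooth_entry.
Qed.

Lemma nablaE X Y y : smooth_on O X -> smooth_on O Y -> O y ->
  nabla X Y y = 'D_(X y) Y y + Y y *m Gam (X y) y.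
Proof.
move=> sX sY Oy; rewrite {1}(sum_coord Y) nabla_sumr //; last first.
- by move=> i; exact: smooth_cst.
- by move=> i; exact: smooth_entry.
rewrite big_split /=; congr (_ + _).
  rewrite [RHS]row_sum_delta; apply: eq_bigr => i _; congr (_ *: _).
  by rewrite /vf_deriv (derive_entry Oy).
rewrite [RHS]mulmx_sum_row; apply: eq_bigr => i _; congr (_ *: _).
by rewrite rowK nabla_pointwise //; exact: smooth_cst.
Qed.

Lemma nabla_cst x z y : O y -> nabla (cst x) (cst z) y = z *m Gam x y.
Proof.
by move=> Oy; rewrite nablaE ?derive_cst ?add0r //; exact: smooth_cst.
Qed.

Lemma smooth_Gam x : smooth_on O (Gam x).
Proof.
apply: (smooth_matrix O_open) => i j.
have -> : (fun q => Gam x q i j) = (fun q => nabla (cst x) (coord_vf i) q 0 j).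
  by apply/funext => q; rewrite mxE.
by apply: (smooth_entry O_open); apply: (lc_smooth lc); exact: smooth_cst.
Qed.

Lemma torsion_Gam x z y : O y -> z *m Gam x y = x *m Gam z y.
Proof.
move=> Oy; apply/subr0_eq; rewrite -!nabla_cst // (lc_torsion lc) //; try exact: smooth_cst.
by rewrite /bracket !derive_cst subrr.
Qed.

(** Vanishing torsion exchanges the direction with the vector multiplied from the left, where
    additivity is that of the matrix product. *)
Lemma Gam_add x z y : O y -> Gam (x + z) y = Gam x y + Gam z y.
Proof.
move=> Oy; apply/row_matrixP => i; rewrite !rowE mulmxDr (torsion_Gam (x + z)) //.
by rewrite (torsion_Gam x) // (torsion_Gam z) // mulmxDl.
Qed.

Lemma Gam_scale k x y : O y -> Gam (k *: x) y = k *: Gam x y.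
Proof.
move=> Oy; apply/row_matrixP => i; rewrite !rowE -scalemxAr (torsion_Gam (k *: x)) //.
by rewrite (torsion_Gam x) // scalemxAl.
Qed.

Lemma metric_Gam x y : O y -> 'D_x g y = Gam x y *m g y + g y *m (Gam x y)^T.
Proof.
move=> Oy; apply/matrixP => i j.
have := lc_metric lc (smooth_cst x) (smooth_cst (delta_mx 0 i)) (smooth_cst (delta_mx 0 j)) Oy.
rewrite /vf_deriv (_ : bil_app _ _ _ = fun q => g q i j); last first.
  by apply/funext => q; rewrite /bil_app /cst form_delta.
rewrite (derive_entry Oy) // => ->; rewrite /bil_app !nabla_cst // /cst trmx_mul !mulmxA.
by rewrite -[_ *m Gam x y *m _]mulmxA -[_ *m g y *m _]mulmxA !form_delta [RHS]mxE.
Qed.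

(** The operator $w\mapsto R(x,z)w$. As matrices act from the right, the two products of Christoffel
    matrices stand in the order opposite to the usual formula. *)
Definition Rm x z y : 'M[R]_m :=
  'D_x (Gam z) y - 'D_z (Gam x) y + Gam z y *m Gam x y - Gam x y *m Gam z y.

Lemma curv_cst x z w y : O y -> curv nabla (cst x) (cst z) (cst w) y = w *m Rm x z y.
Proof.
move=> Oy; rewrite /curv.
have -> : nabla (bracket (cst x) (cst z)) (cst w) y = 0.
  have -> : bracket (cst x) (cst z) = cst 0.
    by apply/funext => q; rewrite /bracket !derive_cst subrr.
  by rewrite nabla_cst // -[X in Gam X](scale0r (0 : E)) Gam_scale // scale0r mulmx0.
have N a b : nabla (cst a) (nabla (cst b) (cst w)) y =
    w *m 'D_a (Gam b) y + w *m Gam b y *m Gam a y.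
  have sW : smooth_on O (nabla (cst b) (cst w)) by apply: (lc_smooth lc); exact: smooth_cst.
  rewrite (nablaE (smooth_cst a) sW Oy) nabla_cst //; congr (_ + _).
  rewrite (derive_eq_on O_open (h := fun q => w *m Gam b q)) //; last by move=> q; exact: nabla_cst.
  by rewrite (derive_mulmx Oy _ (smooth_cst w) (smooth_Gam b)) derive_const mul0mx add0r.
rewrite !N subr0 /Rm !(mulmxDr, mulmxN, mulmxA).
by rewrite opprD addrACA addrA.
Qed.

End Christoffel.

(** * Contact algebra at a point *)

Section Form.
Context {R : realFieldType} {m : nat}.
Local Notation E := 'rV[R]_m.
Implicit Types (x y z : E) (A : 'M[R]_m).

Definition mxform A x y : R := (x *m A *m y^T) 0 0.

Lemma mxformDl A x y z : mxform A (x + y) z = mxform A x z + mxform A y z.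
Proof. by rewrite /mxform !mulmxDl mxE. Qed.
Lemma mxformDr A x y z : mxform A x (y + z) = mxform A x y + mxform A x z.
Proof. by rewrite /mxform linearD mulmxDr mxE. Qed.
Lemma mxformZl A k x y : mxform A (k *: x) y = k * mxform A x y.
Proof. by rewrite /mxform -!scalemxAl mxE. Qed.
Lemma mxformZr A k x y : mxform A x (k *: y) = k * mxform A x y.
Proof. by rewrite /mxform linearZ /= -scalemxAr mxE. Qed.
Lemma mxformNl A x y : mxform A (- x) y = - mxform A x y.
Proof. by rewrite -scaleN1r mxformZl mulN1r. Qed.
Lemma mxformNr A x y : mxform A x (- y) = - mxform A x y.
Proof. by rewrite -scaleN1r mxformZr mulN1r. Qed.
Lemma mxform0l A x : mxform A 0 x = 0.
Proof. by rewrite /mxform !mul0mx mxE. Qed.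
Lemma mxform0r A x : mxform A x 0 = 0.
Proof. by rewrite /mxform trmx0 mulmx0 mxE. Qed.
Definition mxformE := (mxformDl, mxformDr, mxformZl, mxformZr, mxformNl, mxformNr, mxform0l, mxform0r).

End Form.

Section PointwiseAlgebra.
Context {R : realFieldType} {m : nat}.
Local Notation E := 'rV[R]_m.
Implicit Types (x y z w t : E).

(** The forms [u] and [v] do not appear: they are [mxform g ^~ U] and [mxform g ^~ V].
    In matrix products on row vectors the operator applied first stands first, so that
    [K := G *m H] below is [H \o G], which is [J] on horizontal vectors; [J] itself is
    not needed. *)
Record contact_alg (g G H : 'M[R]_m) (U V : E) : Prop := ContactAlg {
  ca_sym : forall x y, mxform g x y = mxform g y x;
  ca_pos : forall x, x != 0 -> 0 < mxform g x x;
  ca_UU : mxform g U U = 1;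
  ca_VV : mxform g V V = 1;
  ca_UV : mxform g U V = 0;
  ca_GG : forall x, x *m G *m G = - x + mxform g x U *: U + mxform g x V *: V;
  ca_HH : forall x, x *m H *m H = - x + mxform g x U *: U + mxform g x V *: V;
  ca_HG : forall x, x *m H *m G = - (x *m G *m H);
  ca_UG : U *m G = 0;
  ca_VG : V *m G = 0;
  ca_UH : U *m H = 0;
  ca_VH : V *m H = 0;
  ca_Gskew : forall x y, mxform g (x *m G) y = - mxform g x (y *m G);
  ca_Hskew : forall x y, mxform g (x *m H) y = - mxform g x (y *m H) }.

(** This duality exchanges the tensors [S] and [T], so that only [G] and [U] need to be treated. *)
Lemma contact_alg_dual g G H U V :
  contact_alg g G H U V -> contact_alg g H (- G) V (- U).
Proof.
case=> sym pos UU VV UV GG HH HG UG VG UH VH Gs Hs; split=> //.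
- by rewrite !mxformE UU opprK.
- by rewrite mxformE sym UV oppr0.
- by move=> x; rewrite HH mxformNr scaleNr scalerN opprK addrAC.
- by move=> x; rewrite !mulmxN mulNmx opprK GG mxformNr scaleNr scalerN opprK addrAC.
- by move=> x; rewrite !(mulmxN, mulNmx) HG opprK.
- by rewrite mulNmx UH oppr0.
- by rewrite mulmxN VG oppr0.
- by rewrite mulmxN mulNmx UG !oppr0.
- by move=> x y; rewrite !mulmxN !mxformE Gs.
Qed.

(** The value of [(nabla_x G) y] on a complex Sasakian manifold. *)
Definition cov_formula (g G H : 'M[R]_m) (U V x y : E) : E :=
  - 2 * mxform g x V *: (y *m (G *m H)) + mxform g y U *: (x *m G *m G)
  - mxform g y V *: (x *m (G *m H)) - mxform g (x *m G *m G) y *: U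
  + mxform g (x *m (G *m H)) y *: V.

(** [g ((nabla_x (nabla G))_z w, t)] for horizontal [x], [z], [w], [t]. *)
Definition cov2_formula (g G H : 'M[R]_m) (x z w t : E) : R :=
  2 * mxform g (x *m H) z * mxform g (w *m (G *m H)) t + mxform g (x *m G) w * mxform g z t
  + mxform g (x *m H) w * mxform g (z *m (G *m H)) t - mxform g z w * mxform g (x *m G) t
  - mxform g (z *m (G *m H)) w * mxform g (x *m H) t.

(** The tensor [S(x, y)], where [nU x] and [D x] are [nabla_x U] and [nabla_x G]. *)
Definition normality (g G H : 'M[R]_m) (U V : E) (nU : E -> E) (D : E -> 'M[R]_m) x y : E :=
  let dot := mxform g in
  y *m D (x *m G) - x *m D (y *m G) - y *m D x *m G + x *m D y *m G
  + (2 * dot x (y *m G)) *: U - (2 * dot x (y *m H)) *: V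
  + 2 *: (dot y V *: (x *m H) - dot x V *: (y *m H))
  + dot (nU (y *m G)) V *: (x *m H) - dot (nU (x *m G)) V *: (y *m H)
  + dot (nU x) V *: (y *m H *m G) - dot (nU y) V *: (x *m H *m G).

(** First-order data at a point: [nU], [nV], [D] stand for the covariant derivatives of $U$, $V$,
    $G$. The fields [nj_UU] to [nj_UV] differentiate constant inner products, [nj_UD] and [nj_VD]
    differentiate $GU=GV=0$, [nj_GG] differentiates the formula for $G^2$, and [nj_closed] is
    $d(du)=0$. *)
Record normal_jet (g G H : 'M[R]_m) (U V : E) (nU nV : E -> E) (D : E -> 'M[R]_m) : Prop :=
  NormalJet {
  nj_add : forall x y, D (x + y) = D x + D y;
  nj_scale : forall k x, D (k *: x) = k *: D x;
  nj_UU : forall x, mxform g (nU x) U = 0;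
  nj_VV : forall x, mxform g (nV x) V = 0;
  nj_UV : forall x, mxform g (nU x) V = - mxform g (nV x) U;
  nj_dU : forall x z, mxform g (nU x) z - mxform g (nU z) x = 2 * mxform g x (z *m G);
  nj_dV : forall x z, mxform g (nV x) z - mxform g (nV z) x = 2 * mxform g x (z *m H);
  nj_UD : forall x, U *m D x = - (nU x *m G);
  nj_VD : forall x, V *m D x = - (nV x *m G);
  nj_skew : forall x y z, mxform g (y *m D x) z = - mxform g y (z *m D x);
  nj_GG : forall x y, y *m G *m D x + y *m D x *m G =
     mxform g y (nU x) *: U + mxform g y U *: nU x + mxform g y (nV x) *: V + mxform g y V *: nV x;
  nj_closed : forall x y z,
    mxform g (y *m D x) z + mxform g (z *m D y) x + mxform g (x *m D z) y = 0;
  nj_normalU : forall x, normality g G H U V nU D x U = 0;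
  nj_normalH : forall x y, mxform g x U = 0 /\ mxform g x V = 0 ->
    mxform g y U = 0 /\ mxform g y V = 0 -> normality g G H U V nU D x y = 0 }.

Section Contact.
Variables (g G H : 'M[R]_m) (U V : E).
Hypothesis ca : contact_alg g G H U V.
Local Notation dot := (mxform g).
Local Notation horizontal x := (dot x U = 0 /\ dot x V = 0).

Lemma dot_inj x y : (forall z, dot x z = dot y z) -> x = y.
Proof.
move=> xy; apply/eqP; rewrite -subr_eq0; apply/negPn/negP => /(ca_pos ca).
by rewrite mxformDl mxformNl xy subrr ltxx.
Qed.

Lemma dotVU : dot V U = 0. Proof. by rewrite (ca_sym ca) (ca_UV ca). Qed.
Lemma dotGU x : dot (x *m G) U = 0.
Proof. by rewrite (ca_Gskew ca) (ca_UG ca) mxform0r oppr0. Qed.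
Lemma dotGV x : dot (x *m G) V = 0.
Proof. by rewrite (ca_Gskew ca) (ca_VG ca) mxform0r oppr0. Qed.
Lemma dotHU x : dot (x *m H) U = 0.
Proof. by rewrite (ca_Hskew ca) (ca_UH ca) mxform0r oppr0. Qed.
Lemma dotHV x : dot (x *m H) V = 0.
Proof. by rewrite (ca_Hskew ca) (ca_VH ca) mxform0r oppr0. Qed.

Lemma GGG x : x *m G *m G *m G = - (x *m G).
Proof. by rewrite (ca_GG ca) dotGU dotGV !scale0r !addr0. Qed.

Lemma HGG x : x *m H *m G *m G = - (x *m H).
Proof. by rewrite (ca_GG ca) dotHU dotHV !scale0r !addr0. Qed.

Lemma dotKU x : dot (x *m (G *m H)) U = 0. Proof. by rewrite mulmxA dotHU. Qed.
Lemma dotKV x : dot (x *m (G *m H)) V = 0. Proof. by rewrite mulmxA dotHV. Qed.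

(** * First derivatives forced by normality *)

Section Normal.
Variables (nU nV : E -> E) (D : E -> 'M[R]_m).
Hypothesis nj : normal_jet g G H U V nU nV D.

Let D_add := nj_add nj.
Let D_scale := nj_scale nj.
Let nUU := nj_UU nj.
Let nVV := nj_VV nj.
Let nUV := nj_UV nj.
Let dU := nj_dU nj.
Let dV := nj_dV nj.
Let UD := nj_UD nj.
Let VD := nj_VD nj.
Let D_skew := nj_skew nj.
Let D_GG := nj_GG nj.
Let D_closed := nj_closed nj.
Let normalU := nj_normalU nj.
Let normalH := nj_normalH nj.
Local Notation normality := (normality g G H U V nU D).

Lemma D0 : D 0 = 0.
Proof. by rewrite -(scale0r (0 : E)) D_scale scale0r. Qed.

(** The equations for $du$ and $dv$ make $\nabla_VU$ and $\nabla_UV$ the metric duals of $\sigma$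
    and $-\sigma$. The equation $S(V,U)=0$ equates their horizontal parts, and their vertical parts
    vanish; hence $\sigma=-\sigma$. *)
Lemma sigma0 x : dot (nU x) V = 0.
Proof.
have nVx z : dot (nU V) z = dot (nU z) V.
  by have := dU V z; rewrite (ca_sym ca V) dotGV mulr0 => /eqP; rewrite subr_eq0 => /eqP.
have nUx z : dot (nV U) z = dot (nV z) U.
  by have := dV U z; rewrite (ca_sym ca U) dotHU mulr0 => /eqP; rewrite subr_eq0 => /eqP.
have sU : dot (nU U) V = 0 by rewrite -nVx nUU.
have sV : dot (nU V) V = 0 by rewrite nUV -nUx nVV oppr0.
have := normalU V; rewrite /normality (ca_VG ca) (ca_UG ca) (ca_UH ca) (ca_VH ca) D0.
rewrite !(mulmx0, mul0mx, mxform0r, mulr0, scale0r, scaler0, subr0, addr0, add0r, mulNmx, UD, VD) opprK.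
rewrite !(ca_GG ca) => S0.
have := congr1 (dot ^~ x) S0.
have nVU0 : dot (nV U) U = 0 by rewrite -[LHS]opprK -nUV sU oppr0.
rewrite !mxformE !(nUU, nVV, sV, nVU0) nVx nUx nUV; lra.
Qed.


(** The symmetric part of [nabla U]. *)
Definition sU x y : R := dot (nU x) y + dot (x *m G) y.

(** The equation $du=\widetilde G$ prescribes the skew part of $\nabla U$ as $-G$. *)
Lemma sU_sym x y : sU x y = sU y x.
Proof.
have := dU x y; rewrite /sU !(ca_Gskew ca) (ca_sym ca y) (ca_Gskew ca); lra.
Qed.

Lemma sU_U x : sU x U = 0. Proof. by rewrite /sU nUU dotGU addr0. Qed.

Lemma nUU0 : nU U = 0.
Proof.
apply: dot_inj => z; have := sU_sym U z.
by rewrite sU_U /sU (ca_UG ca) !mxform0l addr0.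
Qed.

Lemma nVU0 : nV U = 0.
Proof.
apply: dot_inj => z; have := dV U z; rewrite (ca_sym ca U) dotHU mulr0 mxform0l.
by have := nUV z; rewrite sigma0; lra.
Qed.

Lemma normalU_dot x z :
  sU (x *m G) (z *m G) - sU x z + dot (x *m D U *m G) z = 0.
Proof.
have := congr1 (dot ^~ z) (normalU x); rewrite /normality (ca_UG ca) (ca_UH ca) D0 !UD.
rewrite !sigma0 !(mulmx0, mul0mx, mxform0r, mulr0, scale0r, scaler0, subr0, addr0, add0r, mulNmx).
rewrite !(ca_UV ca) !(scale0r, scaler0, addr0) !mxformE !opprK /sU.
rewrite !(ca_Gskew ca) !(ca_GG ca) !(mulmxDl, mulNmx, =^~ scalemxAl) (ca_UG ca) (ca_VG ca).
rewrite !mxformE nUU sigma0 /=; lra.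
Qed.

(** In [normalU_dot] the terms with [sU] are symmetric in [x] and [z]. The term with $\nabla_UG$ is
    skew, because $\nabla_UU=\nabla_UV=0$ makes $G$ anticommute with $\nabla_UG$. So both parts
    vanish separately. *)
Lemma sU_GG x z : sU (x *m G) (z *m G) = sU x z /\ dot (x *m D U *m G) z = 0.
Proof.
have xz := normalU_dot x z; have zx := normalU_dot z x.
have anti : dot (z *m D U *m G) x = - dot (x *m D U *m G) z.
  have -> : x *m D U *m G = - (x *m G *m D U).
    apply/eqP; rewrite -addr_eq0 addrC (D_GG U x) nUU0 nVU0.
    by rewrite !(mxform0r, scale0r, scaler0, addr0).
  by rewrite mxformNl opprK (ca_Gskew ca) D_skew opprK (ca_sym ca).
by move: xz zx; rewrite anti (sU_sym (z *m G)) (sU_sym z); split; lra.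
Qed.

Lemma D_U x : x *m D U = 0.
Proof.
apply: dot_inj => z; rewrite mxform0l.
have [_] := sU_GG x (z *m G); rewrite (ca_Gskew ca) (ca_GG ca) !mxformE.
have -> : dot (x *m D U) U = 0 by rewrite D_skew UD nUU0 mul0mx oppr0 mxform0r oppr0.
have -> : dot (x *m D U) V = 0 by rewrite D_skew VD nVU0 mul0mx oppr0 mxform0r oppr0.
lra.
Qed.

(** That is, $U$ is Killing. Closedness at $(U,a,b)$ with $\nabla_UG=0$ lets [G] pass from one
    argument of [sU] to the other; moving it twice gives a minus sign, while [sU_GG] gives a plus
    sign. *)
Lemma sU0 x z : sU x z = 0.
Proof.
have comm a b : sU a (b *m G) = sU b (a *m G).
  have := D_closed U a b; rewrite D_U mxform0l D_skew !UD mxformNr mxformNl opprK.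
  by rewrite (ca_sym ca b) !(ca_Gskew ca (nU _)) /sU (ca_sym ca (a *m G)); lra.
have := comm (x *m G) z; rewrite (sU_GG x z).1 (ca_GG ca).
have -> : sU z (- x + dot x U *: U + dot x V *: V) = - sU z x.
  rewrite /sU !mxformE !(nUU, sigma0, dotGU, dotGV); ring.
by rewrite (sU_sym z); lra.
Qed.

Lemma nU_G x : nU x = - (x *m G).
Proof.
by apply: dot_inj => z; have := sU0 x z; rewrite /sU mxformNl; lra.
Qed.

(** * The covariant derivative of $G$ *)

Section Formula.
Hypothesis nV_H : forall x, nV x = - (x *m H).
Local Notation K := (G *m H).
Local Notation A x y z := (dot (y *m D x) z).

Lemma U_D x : U *m D x = x *m G *m G.
Proof. by rewrite UD nU_G mulNmx opprK. Qed.

Lemma V_D x : V *m D x = - (x *m K).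
Proof. by rewrite VD nV_H mulNmx opprK (ca_HG ca) mulmxA. Qed.

Lemma K_skew x y : dot (x *m K) y = - dot x (y *m K).
Proof.
by rewrite !mulmxA (ca_Hskew ca) (ca_Gskew ca) (ca_HG ca) mxformNr !opprK.
Qed.

(** In the closedness identity at $(V,x,z)$ the two other terms both equal [dot z (x *m K)], whence
    the factor 2. *)
Lemma D_V x : x *m D V = - 2 *: (x *m K).
Proof.
apply: dot_inj => z; have := D_closed V x z.
rewrite [dot (z *m D x) V]D_skew !V_D mxformNr mxformNl (K_skew z) mxformZl (ca_sym ca (x *m K)); lra.
Qed.

(** The derivative of $G^2$ has only terms containing a vertical factor, so $G$ anticommutes with
    $\nabla_xG$ between horizontal vectors; skewness of $G$ absorbs the sign. *)
Lemma A_move x y z : dot y U = 0 -> dot y V = 0 -> dot z U = 0 -> dot z V = 0 ->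
  A x (y *m G) z = A x y (z *m G).
Proof.
move=> yU yV zU zV; have := congr1 (dot ^~ z) (D_GG x y).
rewrite !mxformE yU yV !(ca_sym ca _ z) zU zV.
by rewrite (ca_sym ca z) (ca_sym ca z) (ca_Gskew ca); lra.
Qed.

Lemma horizontalGG x : dot x U = 0 -> dot x V = 0 -> x *m G *m G = - x.
Proof. by move=> xU xV; rewrite (ca_GG ca) xU xV !scale0r !addr0. Qed.

Lemma A_anti x y z : A x z y = - A x y z.
Proof. by rewrite D_skew (ca_sym ca). Qed.

(** As for almost Kaehler structures: the fundamental form of [G] is closed. *)
Lemma A_quasi x y z : horizontal x -> horizontal y -> horizontal z ->
  A (x *m G) (y *m G) z = - A x y z.
Proof.
move=> [xU xV] [yU yV] [zU zV].
have C1 := D_closed x y z.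
have C2 := D_closed x (y *m G) (z *m G).
have C3 := D_closed (x *m G) y (z *m G).
have C4 := D_closed (x *m G) (y *m G) z.
(* After moving [G], the combination [C1 - C2 + C3 + C4] is twice the sum of [A (x *m G) (y *m G) z]
   and [A x y z]. *)
move: C2 C3 C4; rewrite !(A_move, dotGU, dotGV) //.
rewrite !horizontalGG // !mxformNr; lra.
Qed.

(** Normality makes [A x y z] symmetric in [x] and [y], while it is skew in [y] and [z]. *)
Lemma A_horizontal x y z : horizontal x -> horizontal y -> horizontal z -> A x y z = 0.
Proof.
have hG w : horizontal (w *m G) by rewrite dotGU dotGV.
(* Pairing $S(a,b)=0$ with $-Gw$ leaves two terms with derivatives along $a$ and $b$ and two along
   $Ga$ and $Gb$; [A_quasi] shows that the latter repeat the former, so the equation is twice the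
   claimed symmetry. *)
have sym12 a b w : horizontal a -> horizontal b -> horizontal w -> A a b w = A b a w.
  move=> ha hb [wU wV].
  have ww : w = - (w *m G) *m G by rewrite mulNmx horizontalGG ?opprK.
  have N := congr1 (dot ^~ (- (w *m G))) (normalH ha hb).
  move: (A_quasi ha (hG b) (hG w)) (A_quasi hb (hG a) (hG w)); case: ha hb N => [aU aV] [bU bV].
  rewrite /normality !sigma0 aV bV !mxformE !(ca_sym ca _ (w *m G)) !dotGU !dotGV !(ca_sym ca (w *m G)).
  rewrite !(ca_Gskew ca (_ *m _)) !horizontalGG // !mulNmx !mxformE.
  rewrite !(A_move _ (z := w *m G)) ?dotGU ?dotGV // !horizontalGG // !mxformNr; lra.
move=> hx hy hz.
have := sym12 x y z hx hy hz; have := sym12 x z y hx hz hy; have := sym12 y z x hy hz hx.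
have := A_anti x y z; have := A_anti y x z; have := A_anti z x y; lra.
Qed.

Lemma split_vertical x : x = - (x *m G *m G) + dot x U *: U + dot x V *: V.
Proof. by apply: dot_inj => z; rewrite (ca_GG ca) !mxformE; ring. Qed.

(** Each of [x], [y] and the test vector [z] is split into its horizontal part $-G^2$ and its
    vertical part. The purely horizontal contribution is zero by [A_horizontal]; the vertical ones
    are [D_U], [D_V], [U_D] and [V_D], combined with skewness. *)
Lemma D_formula x y : y *m D x = cov_formula g G H U V x y.
Proof.
rewrite /cov_formula.
have hGG w : horizontal (- (w *m G *m G)) by rewrite !mxformNl dotGU dotGV oppr0.
apply: dot_inj => z.
have DxE a b : A x a b = A (- (x *m G *m G)) a b - 2 * dot x V * dot (a *m K) b.
  rewrite {1}(split_vertical x) !D_add !D_scale !mulmxDr -!scalemxAr D_U D_V !mxformE; ring.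
have y0K : - (y *m G *m G) *m K = y *m K.
  by rewrite mulNmx !mulmxA GGG mulNmx opprK.
have yDU : dot (- (y *m G *m G) *m D x) U = - dot (x *m G *m G) y.
  by rewrite D_skew U_D mxformNl opprK (ca_Gskew ca (y *m G)) (ca_Gskew ca y) opprK
     GGG mxformNr (ca_sym ca).
have yDV : dot (- (y *m G *m G) *m D x) V = dot (x *m K) y.
  by rewrite D_skew V_D !mxformE opprK (ca_Gskew ca) (ca_Gskew ca) opprK mulmxA HGG mxformNr opprK (ca_sym ca).
have hh := A_horizontal (hGG x) (hGG y) (hGG z).
have -> : A x y z = A x (- (y *m G *m G)) z + dot y U * dot (x *m G *m G) z - dot y V * dot (x *m K) z.
  by rewrite {1}(split_vertical y) !mulmxDl -!scalemxAl U_D V_D !mxformE; ring.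
have -> : A x (- (y *m G *m G)) z = A x (- (y *m G *m G)) (- (z *m G *m G))
    - dot z U * dot (x *m G *m G) y + dot z V * dot (x *m K) y.
  by rewrite {1}(split_vertical z) !(mxformDr, mxformZr) yDU yDV; ring.
have -> : A x (- (y *m G *m G)) (- (z *m G *m G)) = - 2 * dot x V * dot (y *m K) z.
  rewrite DxE hh y0K {2}(split_vertical z) !(mxformDr, mxformZr).
  by rewrite dotKU dotKV; ring.
rewrite !(mxformDl, mxformZl, mxformNl) (ca_sym ca U) (ca_sym ca V); ring.
Qed.

End Formula.

End Normal.
End Contact.
End PointwiseAlgebra.

(** * Curvature algebra at a point *)

(** Second-order data at a point. The fields [cj_V] and [cj_H] are [cj_U] and [cj_G] for the dual
    structure. Restricting the commutators to horizontal arguments removes every term with a factor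
    $u$ or $v$ of an argument. *)
Record curvature_jet (R : realFieldType) (m : nat) (g G H : 'M[R]_m) (U V : 'rV[R]_m)
    (Rm : 'rV[R]_m -> 'rV[R]_m -> 'M[R]_m) : Prop := CurvatureJet {
  cj_add : forall x y z, Rm x (y + z) = Rm x y + Rm x z;
  cj_scale : forall k x y, Rm x (k *: y) = k *: Rm x y;
  cj_anti : forall x y, Rm x y = - Rm y x;
  cj_bianchi : forall x y z, z *m Rm x y + x *m Rm y z + y *m Rm z x = 0;
  cj_skew : forall x y z w, mxform g (z *m Rm x y) w = - mxform g z (w *m Rm x y);
  cj_U : forall x z, U *m Rm x z = cov_formula g G H U V z x - cov_formula g G H U V x z;
  cj_V : forall x z, V *m Rm x z =
    cov_formula g H (- G) V (- U) z x - cov_formula g H (- G) V (- U) x z;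
  cj_G : forall x z w t, mxform g x U = 0 /\ mxform g x V = 0 ->
    mxform g z U = 0 /\ mxform g z V = 0 -> mxform g w U = 0 /\ mxform g w V = 0 ->
    mxform g t U = 0 /\ mxform g t V = 0 ->
    mxform g (w *m (G *m Rm x z - Rm x z *m G)) t =
    cov2_formula g G H x z w t - cov2_formula g G H z x w t;
  cj_H : forall x z w t, mxform g x U = 0 /\ mxform g x V = 0 ->
    mxform g z U = 0 /\ mxform g z V = 0 -> mxform g w U = 0 /\ mxform g w V = 0 ->
    mxform g t U = 0 /\ mxform g t V = 0 ->
    mxform g (w *m (H *m Rm x z - Rm x z *m H)) t =
    cov2_formula g H (- G) x z w t - cov2_formula g H (- G) z x w t }.

Section CurvatureAlgebra.
Context {R : realFieldType} {m : nat}.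
Local Notation E := 'rV[R]_m.
Implicit Types (x y z w t a b : E) (M N L : 'M[R]_m).
Variables (g G H : 'M[R]_m) (U V : E).
Hypothesis ca : contact_alg g G H U V.
Local Notation dot := (mxform g).
Local Notation horizontal x := (dot x U = 0 /\ dot x V = 0).
Local Notation K := (G *m H).
Local Notation h := (m%:R - 2 : R).

Lemma mx_form_eq M N : (forall x y, mxform M x y = mxform N x y) -> M = N.
Proof.
move=> MN; apply/matrixP => i j; have := MN (delta_mx 0 i) (delta_mx 0 j).
by rewrite /mxform !trmx_delta -!rowE -!colE !mxE.
Qed.

Lemma mxform_bilinear (b : E -> E -> R) x y :
  (forall x y z, b (x + y) z = b x z + b y z) -> (forall k x y, b (k *: x) y = k * b x y) ->
  (forall x y z, b x (y + z) = b x y + b x z) -> (forall k x y, b x (k *: y) = k * b x y) ->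
  mxform (\matrix_(i, j) b (delta_mx 0 i) (delta_mx 0 j)) x y = b x y.
Proof.
move=> addl scalel addr scaler.
have suml z : b x z = \sum_i x 0 i * b (delta_mx 0 i) z.
  rewrite {1}(row_sum_delta x); elim/big_rec2: _ => [|i u v _ <-].
    by rewrite -(scale0r (0 : E)) scalel mul0r.
  by rewrite addl scalel.
have sumr z : b z y = \sum_i y 0 i * b z (delta_mx 0 i).
  rewrite {1}(row_sum_delta y); elim/big_rec2: _ => [|i u v _ <-].
    by rewrite -(scale0r (0 : E)) scaler mul0r.
  by rewrite addr scaler.
rewrite sumr /mxform mxE; apply: eq_bigr => j _; rewrite suml !mxE mulrC; congr (_ * _).
by apply: eq_bigr => i _; rewrite mxE.
Qed.

Lemma mxform_tr M x y : mxform M^T x y = mxform M y x.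
Proof.
rewrite /mxform; have -> : x *m M^T *m y^T = (y *m M *m x^T)^T; last by rewrite mxE.
by rewrite !trmx_mul trmxK mulmxA.
Qed.

Lemma mxform_mulmxl M x y : dot (x *m M) y = mxform (M *m g) x y.
Proof. by rewrite /mxform mulmxA. Qed.

Lemma g_unit : g \in unitmx.
Proof.
rewrite unitmxE unitfE; apply/negP => /det0P[v v0 vg].
by have := ca_pos ca v0; rewrite /mxform vg mul0mx mxE ltxx.
Qed.

Lemma tr_adjoint M N : (forall x y, dot (x *m M) y = dot x (y *m N)) -> \tr M = \tr N.
Proof.
move=> MN; have MgN : M *m g = g *m N^T.
  apply: mx_form_eq => x y; rewrite -mxform_mulmxl MN /mxform trmx_mul !mulmxA //.
by rewrite -[M](mulmxK g_unit) MgN mxtrace_mulC mulKmx ?g_unit // mxtrace_tr.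
Qed.

Lemma tr_skew M : (forall x y, dot (x *m M) y = - dot x (y *m M)) -> \tr M = 0.
Proof.
move=> Ms; have : \tr M = \tr (- M).
  by apply: tr_adjoint => x y; rewrite Ms mulmxN mxformNr.
by rewrite raddfN /=; lra.
Qed.

(** Here [g *m a^T *m b] is the rank-one operator $w\mapsto g(w,a)b$; the curvature commutators,
    read as operators, are largely sums of such terms. *)
Lemma tr_rank1 M a b : \tr (M *m (g *m a^T) *m b) = dot (b *m M) a.
Proof. by rewrite mxtrace_mulC !mulmxA /mxtrace big_ord1. Qed.

Lemma mul_rank1 z M a b : z *m (M *m (g *m a^T) *m b) = dot (z *m M) a *: b.
Proof. by rewrite !mulmxA [z *m M *m g *m a^T]mx11_scalar mul_scalar_mx. Qed.

Lemma tr_commutator M N L : \tr ((M *m N - N *m M) *m L) = \tr (N *m (L *m M)) - \tr (N *m (M *m L)).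
Proof. by rewrite mulmxBl raddfB /= -mulmxA mxtrace_mulC -!mulmxA. Qed.

Local Notation Pi := (- (G *m G)).

Lemma PiE x : x *m Pi = x - dot x U *: U - dot x V *: V.
Proof. by rewrite mulmxN mulmxA (ca_GG ca); apply: (dot_inj ca) => z; rewrite !mxformE; ring. Qed.

Lemma horizontal_Pi x : horizontal (x *m Pi).
Proof. by rewrite mulmxN mulmxA !mxformNl (dotGU ca) (dotGV ca) oppr0. Qed.

(** [Pi] is the orthogonal projection onto the horizontal space, and the identity is [Pi] plus the
    rank-one projections onto [U] and [V]. *)
Lemma tr_split M : \tr M = \tr (Pi *m M *m Pi) + dot (U *m M) U + dot (V *m M) V.
Proof.
have PiPi : Pi *m Pi = Pi.
  apply/row_matrixP => i; rewrite !rowE mulmxA [LHS]PiE.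
  by have [-> ->] := horizontal_Pi (delta_mx 0 i); rewrite !scale0r !subr0.
have M1 : M = Pi *m M + 1%:M *m (g *m U^T) *m (U *m M) + 1%:M *m (g *m V^T) *m (V *m M).
  apply/row_matrixP => i; rewrite !rowE !mulmxDr !mul_rank1 mulmxA PiE !mulmx1.
  by rewrite !mulmxBl -!scalemxAl addrAC subrK subrK.
rewrite [in LHS]M1 !mxtraceD !tr_rank1 !mulmx1; congr (_ + _ + _).
by rewrite -{1}PiPi -mulmxA mxtrace_mulC.
Qed.

Lemma tr_horizontal M N :
  (forall w t, horizontal w -> horizontal t -> dot (w *m M) t = dot (w *m N) t) ->
  \tr M - dot (U *m M) U - dot (V *m M) V = \tr N - dot (U *m N) U - dot (V *m N) V.
Proof.
move=> MN; rewrite (tr_split M) (tr_split N).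
have -> : Pi *m M *m Pi = Pi *m N *m Pi; last by ring.
have Pi_sym x y : dot (x *m Pi) y = dot x (y *m Pi).
  by rewrite !mulmxN !mulmxA !mxformE !(ca_Gskew ca) opprK.
apply/row_matrixP => i; rewrite !rowE !mulmxA; apply: (dot_inj ca) => t.
by rewrite !Pi_sym MN //; exact: horizontal_Pi.
Qed.

(** $-G^2$ is the horizontal projection, so [h] is the real dimension of the horizontal space. *)
Lemma tr_GG : \tr (G *m G) = - h.
Proof.
have -> : G *m G = - 1%:M + 1%:M *m (g *m U^T) *m U + 1%:M *m (g *m V^T) *m V.
  by apply/row_matrixP => i; rewrite !rowE !mulmxDr !mul_rank1 mulmxA (ca_GG ca) mulmxN !mulmx1.
by rewrite !mxtraceD !tr_rank1 !mulmx1 (ca_UU ca) (ca_VV ca) raddfN /= mxtrace1; ring.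
Qed.

(** * Ricci and scalar curvature *)

Section Curvature.
Variable Rm : E -> E -> 'M[R]_m.
Hypothesis cj : curvature_jet g G H U V Rm.

Let Rm_add := cj_add cj.
Let Rm_scale := cj_scale cj.
Let Rm_anti := cj_anti cj.
Let bianchi := cj_bianchi cj.
Let Rm_skew := cj_skew cj.
Let Rm_U := cj_U cj.
Let Rm_V := cj_V cj.
Let Rm_G := cj_G cj.
Let Rm_H := cj_H cj.

Lemma pair_sym x y z w : dot (z *m Rm x y) w = dot (x *m Rm z w) y.
Proof.
have B a b c d := congr1 (fun v => dot v d) (bianchi a b c).
have := B x y z w; have := B y z w x; have := B z w x y; have := B w x y z.
have S a b c d := Rm_skew a b c d.
have A a b c d : dot (c *m Rm a b) d = - dot (c *m Rm b a) d.
  by rewrite Rm_anti mulmxN mxformNl.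
have T a b c d : dot (c *m Rm a b) d = - dot (d *m Rm a b) c.
  by rewrite S (ca_sym ca).
rewrite !mxformE.
have := T x y z w; have := T z w x y; have := T x z y w; have := T w x y z; have := T y z x w.
have := T y w x z; have := A w y z x; have := A x z y w; lra.
Qed.

(** [z |-> R(x, z)y] *)
Definition curv_op x y : 'M[R]_m := \matrix_i (y *m Rm x (delta_mx 0 i)).

Lemma Rm0 x : Rm x 0 = 0.
Proof. by rewrite -(scale0r (0 : E)) Rm_scale scale0r. Qed.

Lemma mul_curv_op x y z : z *m curv_op x y = y *m Rm x z.
Proof.
rewrite mulmx_sum_row {2}(row_sum_delta z).
have -> : Rm x (\sum_j z 0 j *: delta_mx 0 j) = \sum_j z 0 j *: Rm x (delta_mx 0 j).
  elim/big_rec2: _ => [|j M v _ <-]; first exact: Rm0.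
  by rewrite Rm_add Rm_scale.
rewrite mulmx_sumr; apply: eq_bigr => j _.
by rewrite rowK -scalemxAr.
Qed.

Lemma curv_op_adjoint x y z w : dot (z *m curv_op x y) w = dot z (w *m curv_op y x).
Proof. by rewrite !mul_curv_op (ca_sym ca z) [RHS]pair_sym. Qed.

Lemma Rm_curv_op x y : Rm x y = curv_op x y - curv_op y x.
Proof.
apply/row_matrixP => i; rewrite !rowE mulmxBr !mul_curv_op; set z := delta_mx _ _.
have /eqP := bianchi x y z; rewrite -addrA addr_eq0 => /eqP ->.
by rewrite (Rm_anti z x) mulmxN opprD opprK addrC.
Qed.

(** By Bianchi and pair symmetry [Rm x y] is [curv_op x y] minus its adjoint; against the skew
    operator [G] the two contributions add up. *)
Lemma tr_Rm_G_curv_op x y : \tr (Rm x y *m G) = 2 * \tr (curv_op x y *m G).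
Proof.
have E : \tr (curv_op x y *m G) = \tr (- (G *m curv_op y x)).
  apply: tr_adjoint => z w.
  by rewrite mulmxA (ca_Gskew ca) curv_op_adjoint mulmxN mulmxA mxformNr.
rewrite Rm_curv_op mulmxBl raddfB /=.
have -> : \tr (curv_op y x *m G) = - \tr (curv_op x y *m G); last by ring.
by rewrite E raddfN /= opprK mxtrace_mulC.
Qed.

(** The sign is due to [curv_op], which puts the traced vector in the second slot of $R$, whereas
    Ricci traces over the first. *)
Definition ric x y : R := - \tr (curv_op x y).

Lemma KHE x : x *m K *m H = - (x *m G).
Proof. by rewrite mulmxA (ca_HH ca) (dotGU ca) (dotGV ca) !scale0r !addr0. Qed.

Lemma GHGE x : x *m G *m H *m G = x *m H.
Proof.
rewrite (ca_HG ca) -[RHS]opprK; congr (- _).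
by rewrite (ca_GG ca) !mulmxDl mulNmx -!scalemxAl (ca_UH ca) (ca_VH ca) !scaler0 !addr0.
Qed.

Lemma HKE x : x *m H *m K = x *m G.
Proof. by rewrite mulmxA (ca_HG ca) mulNmx -mulmxA KHE opprK. Qed.

Lemma KKE x : x *m K *m K = x *m G *m G.
Proof. by rewrite !mulmxA GHGE (ca_HH ca) (ca_GG ca). Qed.

Lemma cov2_dual x z w t : cov2_formula g H (- G) x z w t =
  - 2 * dot (x *m G) z * dot (w *m K) t + dot (x *m H) w * dot z t
  - dot (x *m G) w * dot (z *m K) t - dot z w * dot (x *m H) t
  + dot (z *m K) w * dot (x *m G) t.
Proof.
have HGK a : a *m (H *m - G) = a *m K by rewrite mulmxN mulmxN !mulmxA (ca_HG ca) opprK.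
by rewrite /cov2_formula !HGK !mulmxN !mxformE; ring.
Qed.

(** [G] is, up to sign, the product of the anticommuting [H] and [K], and the commutator of
    [Rm x z] with [H] is known; this determines the trace of [Rm x z *m G]. *)
Lemma tr_Rm_G x z : horizontal x -> horizontal z ->
  \tr (Rm x z *m G) = - 2 * h * dot (x *m G) z.
Proof.
move=> hx hz; pose M := (H *m Rm x z - Rm x z *m H) *m K.
have trM : \tr M = - 2 * \tr (Rm x z *m G).
  have KH : K *m H = - G by apply/row_matrixP => i; rewrite !rowE mulmxA KHE mulmxN.
  have HK : H *m K = G by apply/row_matrixP => i; rewrite !rowE mulmxA HKE.
  by rewrite /M tr_commutator KH HK mulmxN raddfN /=; ring.
pose rk a b : 'M[R]_m := 1%:M *m (g *m a^T) *m b.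
(* The right-hand side of [cj_H] followed by [K], as an operator in [w]. The term $-2g(Gx,z)K$ of
   [cov2_dual] changes sign under exchange of [x] and [z], so it doubles to the factor 4. *)
pose N := (- 4 * dot (x *m G) z) *: (K *m K)
  + rk (x *m H) (z *m K) - rk (z *m H) (x *m K) - rk (x *m G) (z *m K *m K)
  + rk (z *m G) (x *m K *m K) - rk z (x *m H *m K) + rk x (z *m H *m K)
  + rk (z *m K) (x *m G *m K) - rk (x *m K) (z *m G *m K).
have mul_rk w a b : w *m rk a b = dot w a *: b by rewrite /rk mul_rank1 mulmx1.
have tr_rk a b : \tr (rk a b) = dot b a by rewrite /rk tr_rank1 mulmx1.
have vertical : dot (U *m N) U = 0 /\ dot (V *m N) V = 0.
  rewrite /N !(mulmxDr, mulmxN, mul_rk) -!scalemxAr !mxformE [K *m K]mulmxA.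
  rewrite -[G *m H *m G]mulmxA !mulmxA !(ca_UG ca) !(ca_VG ca) !mul0mx !mxformE.
  rewrite !(dotHU ca) !(dotHV ca).
  by split; ring.
have MN : forall w t, horizontal w -> horizontal t -> dot (w *m M) t = dot (w *m N) t.
  move=> w t hw ht; have htK : horizontal (t *m K) by rewrite (dotKU ca) (dotKV ca).
  rewrite /M mulmxA (K_skew ca) Rm_H // !cov2_dual.
  rewrite /N !(mulmxDr, mulmxN, mul_rk) -!scalemxAr [w *m (K *m K)]mulmxA !mxformE.
  rewrite !(K_skew ca _ t).
  have -> : dot (z *m G) x = - dot (x *m G) z by rewrite (ca_Gskew ca) (ca_sym ca).
  by rewrite !(ca_sym ca w); ring.
have := tr_horizontal MN; rewrite vertical.1 vertical.2.
have -> : dot (U *m M) U = 0 by rewrite /M mulmxA (dotKU ca).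
have -> : dot (V *m M) V = 0 by rewrite /M mulmxA (dotKV ca).
have KK : K *m K = G *m G by apply/row_matrixP => i; rewrite !rowE mulmxA KKE mulmxA.
have [xU xV] := hx; have [zU zV] := hz.
(* The eight rank-one traces are all $\pm g(Gx,z)$ and cancel in total; only the multiple of
   [K *m K], of trace [- h], contributes. *)
rewrite trM /N !(mxtraceD, mxtraceZ, raddfN) /= !tr_rk KK tr_GG !subr0 !HKE !KKE.
rewrite !(horizontalGG ca) // !mxformE.
have zx : dot (z *m G) x = - dot (x *m G) z by rewrite (ca_Gskew ca) (ca_sym ca).
have -> : dot (z *m K) (x *m H) = - dot (x *m G) z.
  by rewrite (K_skew ca) HKE (ca_sym ca).
have -> : dot (x *m K) (z *m H) = dot (x *m G) z.
  by rewrite (K_skew ca) HKE -(ca_Gskew ca).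
have KKdot a b : horizontal b -> dot (a *m K) (b *m K) = dot a b.
  by move=> [bU bV]; rewrite (K_skew ca) KKE (horizontalGG ca) // mxformNr opprK.
rewrite !KKdot // (ca_sym ca z) (ca_sym ca x) zx; lra.
Qed.

Lemma Rm_UxU x : U *m Rm x U = - (x *m G *m G).
Proof.
rewrite Rm_U /cov_formula !mulmxA (ca_UG ca) !mul0mx !mxformE !(dotGU ca) !(dotHU ca).
by rewrite (ca_UU ca) (ca_UV ca) !(mulr0, scale0r, scaler0, oppr0, addr0, subr0, add0r, sub0r, scale1r).
Qed.

Lemma Rm_VxV x : V *m Rm x V = - (x *m H *m H).
Proof.
rewrite Rm_V /cov_formula !mulmxN !mulmxA (ca_VH ca) !mul0mx !mxformE !(dotGV ca) !(dotHV ca).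
by rewrite (ca_VV ca) (dotVU ca) !(mulr0, scale0r, scaler0, oppr0, addr0, subr0, add0r, sub0r, scale1r).
Qed.

(** The commutator with $G$ is applied to the fixed vector [y] and traced over the second curvature
    slot. The vertical entries of [M] and [N] agree, the multiple of the identity contributes
    $m=h+2$ and the rank-one terms contribute $-6$. *)
Lemma tr_P x y : horizontal x -> horizontal y ->
  \tr (curv_op x (y *m G) - curv_op x y *m G) = (h - 4) * dot (x *m G) y.
Proof.
move=> hx hy; pose M := curv_op x (y *m G) - curv_op x y *m G.
have [xU xV] := hx; have [yU yV] := hy.
have mulM z : z *m M = y *m (G *m Rm x z - Rm x z *m G).
  by rewrite /M !mulmxBr !mulmxA !mul_curv_op.
pose rk a b : 'M[R]_m := 1%:M *m (g *m a^T) *m b.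
pose rk' L a b : 'M[R]_m := L *m (g *m a^T) *m b.
pose N := 2 *: rk (x *m H) (y *m K) + dot (x *m G) y *: 1%:M + dot (x *m H) y *: K
  - rk y (x *m G) - rk' K y (x *m H) - 2 *: rk' H x (y *m K) - rk' G y x
  - rk' H y (x *m K) + dot x y *: G + dot (x *m K) y *: H.
have mul_rk w a b : w *m rk a b = dot w a *: b by rewrite /rk mul_rank1 mulmx1.
have mul_rk' w L a b : w *m rk' L a b = dot (w *m L) a *: b by rewrite /rk' mul_rank1.
have tr_rk a b : \tr (rk a b) = dot b a by rewrite /rk tr_rank1 mulmx1.
have tr_rk' L a b : \tr (rk' L a b) = dot (b *m L) a by rewrite /rk' tr_rank1.
have MN : forall w t, horizontal w -> horizontal t -> dot (w *m M) t = dot (w *m N) t.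
  move=> w t hw ht; rewrite mulM Rm_G // /cov2_formula /N.
  rewrite !(mulmxDr, mulmxN, mul_rk, mul_rk', =^~ scalemxAr) !mxformE mulmx1 !(ca_sym ca w); ring.
have UN : dot (U *m N) U = dot (x *m G) y /\ dot (V *m N) V = dot (x *m G) y.
  rewrite /N !(mulmxDr, mulmxN, mul_rk, mul_rk', =^~ scalemxAr) !mxformE !mulmxA mulmx1.
  rewrite !(ca_UG ca) !(ca_VG ca) !(ca_UH ca) !(ca_VH ca) !mul0mx !mxformE !mulmx1 (ca_UU ca) (ca_VV ca).
  rewrite !(dotHU ca) !(dotHV ca) !(dotGU ca) !(dotGV ca).
  by split; ring.
have UM : dot (U *m M) U = dot (x *m G) y.
  rewrite mulM mulmxBr mxformDl mxformNl !mulmxA (dotGU ca) subr0 Rm_skew Rm_UxU.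
  by rewrite (horizontalGG ca) // opprK (ca_Gskew ca y) opprK (ca_sym ca).
have VM : dot (V *m M) V = dot (x *m G) y.
  rewrite mulM mulmxBr mxformDl mxformNl !mulmxA (dotGV ca) subr0 Rm_skew Rm_VxV.
  by rewrite (ca_HH ca) xU xV !scale0r !addr0 opprK (ca_Gskew ca y) opprK (ca_sym ca).
have trK : \tr K = 0 by apply: tr_skew; exact: (K_skew ca).
have trG : \tr G = 0 by apply: tr_skew; exact: (ca_Gskew ca).
have trH : \tr H = 0 by apply: tr_skew; exact: (ca_Hskew ca).
have := tr_horizontal MN; rewrite UM VM UN.1 UN.2 /N.
rewrite !(mxtraceD, mxtraceZ, raddfN) /= !tr_rk !tr_rk' mxtrace1 trK trG trH mxtraceZ tr_rk'.
have -> : dot (y *m K) (x *m H) = - dot (x *m G) y by rewrite (K_skew ca) HKE (ca_sym ca).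
have -> : dot (x *m H *m K) y = dot (x *m G) y by rewrite HKE.
have -> : dot (x *m K *m H) y = - dot (x *m G) y by rewrite KHE mxformNl.
have -> : dot (y *m K *m H) x = dot (x *m G) y.
  by rewrite KHE mxformNl (ca_Gskew ca) opprK (ca_sym ca).
lra.
Qed.

(** With [y] written as $Gw$, the lemmas [tr_Rm_G] and [tr_P] give the trace of [curv_op x y] as
    $(h-4)-h$ times $g(Gx,w)=-g(x,y)$. *)
Lemma ric_horizontal x y : horizontal x -> horizontal y -> ric x y = - 4 * dot x y.
Proof.
move=> hx hy; have hyG : horizontal (- (y *m G)) by rewrite !mxformNl (dotGU ca) (dotGV ca) oppr0.
have -> : y = - (y *m G) *m G by rewrite mulNmx (horizontalGG ca) ?opprK //; case: hy.
have := tr_P hx hyG; rewrite raddfB /=; set w := - (y *m G) in hyG *.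
have := tr_Rm_G hx hyG; rewrite tr_Rm_G_curv_op /ric -[dot x _]opprK -(ca_Gskew ca); lra.
Qed.

Lemma ricUU : ric U U = h.
Proof.
rewrite /ric (_ : curv_op U U = G *m G) ?tr_GG ?opprK //.
by apply/row_matrixP => i; rewrite !rowE mul_curv_op Rm_anti mulmxN Rm_UxU opprK mulmxA.
Qed.

Lemma ricVV : ric V V = h.
Proof.
rewrite /ric (_ : curv_op V V = G *m G) ?tr_GG ?opprK //.
apply/row_matrixP => i; rewrite !rowE mul_curv_op Rm_anti mulmxN Rm_VxV opprK mulmxA.
by rewrite (ca_HH ca) (ca_GG ca).
Qed.

Lemma ric_addr x y z : ric x (y + z) = ric x y + ric x z.
Proof.
rewrite /ric -opprD -mxtraceD; congr (- \tr _); apply/row_matrixP => i.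
by rewrite !rowE mulmxDr !mul_curv_op mulmxDl.
Qed.

Lemma ric_scaler k x y : ric x (k *: y) = k * ric x y.
Proof.
rewrite /ric mulrN -mxtraceZ; congr (- \tr _); apply/row_matrixP => i.
by rewrite !rowE -scalemxAr !mul_curv_op -scalemxAl.
Qed.

Lemma ric_addl x y z : ric (x + y) z = ric x z + ric y z.
Proof.
rewrite /ric -opprD -mxtraceD; congr (- \tr _); apply/row_matrixP => i.
by rewrite !rowE mulmxDr !mul_curv_op !(Rm_anti _ (delta_mx _ _)) Rm_add opprD mulmxDr.
Qed.

Lemma ric_scalel k x y : ric (k *: x) y = k * ric x y.
Proof.
rewrite /ric mulrN -mxtraceZ; congr (- \tr _); apply/row_matrixP => i.
by rewrite !rowE -scalemxAr !mul_curv_op !(Rm_anti _ (delta_mx _ _)) Rm_scale !mulmxN -scalemxAr scalerN.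
Qed.

Definition scal : R := \sum_i \sum_j invmx g i j * ric (delta_mx 0 i) (delta_mx 0 j).

Lemma scalE : scal = - 2 * h.
Proof.
pose B : 'M[R]_m := \matrix_(i, j) ric (delta_mx 0 i) (delta_mx 0 j).
have BE x y : mxform B x y = ric x y.
  by apply: mxform_bilinear; [exact: ric_addl|exact: ric_scalel|exact: ric_addr|exact: ric_scaler].
have -> : scal = \tr (invmx g *m B^T).
  by apply: eq_bigr => i _; rewrite mxE; apply: eq_bigr => j _; rewrite !mxE.
have gT : g^T = g.
  by apply: mx_form_eq => x y; rewrite mxform_tr (ca_sym ca).
have outer (c : 'cV[R]_m) (r : 'rV[R]_m) x y :
    mxform (c *m r) x y = (x *m c) 0 0 * (r *m y^T) 0 0.
  by rewrite /mxform mulmxA -mulmxA mxE big_ord1.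
have tr_outer (c : 'cV[R]_m) (r : 'rV[R]_m) : \tr (invmx g *m (c *m r)^T) = (r *m invmx g *m c) 0 0.
  rewrite trmx_mul mulmxA mxtrace_mulC !mulmxA /mxtrace big_ord1.
  have -> : c^T *m invmx g *m r^T = (r *m invmx g *m c)^T; last by rewrite mxE.
  by rewrite !trmx_mul trmx_inv gT mulmxA.
(* Splitting off the vertical parts this way spares the mixed values of Ricci: the traces of the
   second and third terms contain [U *m Pi] and [V *m Pi], which are zero, and the last two give
   only $\rho(U,U)$ and $\rho(V,V)$. *)
have BD : B = - 4 *: (Pi *m g) + (Pi *m B *m U^T) *m (U *m g) + (Pi *m B *m V^T) *m (V *m g)
    + (g *m U^T) *m (U *m B) + (g *m V^T) *m (V *m B).
  apply: mx_form_eq => x y.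
  have addB M N : mxform (M + N) x y = mxform M x y + mxform N x y.
    by rewrite /mxform mulmxDr mulmxDl mxE.
  rewrite !addB !outer !mulmxA -![(_ *m B *m _) 0 0]/(mxform B _ _) -![(_ *m g *m _) 0 0]/(dot _ _).
  have -> : mxform (- 4 *: (Pi *m g)) x y = - 4 * dot (x *m Pi) (y *m Pi).
    have [pU pV] := horizontal_Pi x.
    rewrite (PiE y) !(mxformDr, mxformNr, mxformZr) pU pV.
    by rewrite /mxform -scalemxAr -scalemxAl mxE !mulmxA; ring.
  rewrite !BE -ric_horizontal; [|exact: horizontal_Pi..].
  have split z : z = z *m Pi + dot z U *: U + dot z V *: V.
    by rewrite mulmxN mulmxA; exact: (split_vertical ca).
  rewrite (ca_sym ca U) (ca_sym ca V) {1}(split x) !(ric_addl, ric_scalel).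
  by rewrite {1}(split y) !(ric_addr, ric_scaler); ring.
have trD M N : \tr (invmx g *m (M + N)^T) = \tr (invmx g *m M^T) + \tr (invmx g *m N^T).
  by rewrite linearD /= mulmxDr mxtraceD.
have -> : \tr (invmx g *m B^T) = - 4 * \tr Pi + ric U U + ric V V.
  rewrite [in LHS]BD !trD !tr_outer linearZ /= -scalemxAr mxtraceZ trmx_mul gT mulKmx ?g_unit //.
  rewrite mxtrace_tr !mulmxA !(mulmxKV g_unit) !(mulmxK g_unit).
  rewrite -![(_ *m B *m _) 0 0]/(mxform B _ _) !BE.
  have ric0 z : ric 0 z = 0 by rewrite -(scale0r (0 : E)) ric_scalel mul0r.
  have -> : U *m Pi = 0 by rewrite mulmxN mulmxA (ca_UG ca) mul0mx oppr0.
  have -> : V *m Pi = 0 by rewrite mulmxN mulmxA (ca_VG ca) mul0mx oppr0.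
  by rewrite !ric0 !addr0.
by rewrite ricUU ricVV raddfN /= tr_GG; ring.
Qed.

Lemma Rm_e_Ke e : horizontal e -> dot (U *m Rm e (e *m K)) V = - 2 * dot e e.
Proof.
move=> [eU eV]; rewrite Rm_U /cov_formula !mxformE.
rewrite !(dotGV ca) !(dotKV ca) !(dotKU ca) eU eV (ca_UV ca) (ca_VV ca).
have -> : dot (e *m K *m K) e = - dot e e by rewrite KKE (horizontalGG ca) // mxformNl.
have -> : dot (e *m K) (e *m K) = dot e e by rewrite (K_skew ca) KKE (horizontalGG ca) // mxformNr opprK.
ring.
Qed.

Lemma Rm_e_U e : horizontal e -> dot (e *m K *m Rm e U) V = - dot e e.
Proof.
move=> [eU eV]; rewrite Rm_skew Rm_V /cov_formula.
have HGK a : a *m (H *m - G) = a *m K by rewrite mulmxN mulmxN !mulmxA (ca_HG ca) opprK.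
rewrite !HGK !mulmxA (ca_UH ca) (ca_UG ca) !mul0mx !mxformE eU eV (ca_UU ca) (ca_UV ca).
rewrite !(dotHU ca) !(dotHV ca).
have -> : dot (e *m G *m H) (e *m G *m H) = dot e e.
  by rewrite -!mulmxA (K_skew ca) KKE (horizontalGG ca) // mxformNr opprK.
ring.
Qed.

(** The projection [Pi] has trace [h], so it cannot kill all basis vectors. *)
Lemma exists_horizontal : h != 0 -> exists e, horizontal e /\ e != 0.
Proof.
move=> h0; case: (pickP (fun i => delta_mx 0 i *m Pi != 0 :> E)) => [i Pi_i|Pi0].
  by exists (delta_mx 0 i *m Pi); split => //; exact: horizontal_Pi.
have /eqP : G *m G = 0.
  apply/oppr_inj; rewrite oppr0; apply/row_matrixP => i.
  by have /negbFE/eqP := Pi0 i; rewrite rowE row0.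
move=> /eqP GG0; have /eqP := tr_GG.
by rewrite GG0 mxtrace0 eq_sym oppr_eq0 (negPf h0).
Qed.

Lemma B_coefficients (A : nat -> R) : 0 < h ->
  (forall X Y Z W,
     A 0%N * dot (Z *m Rm X Y) W + A 1%N * dot (Y *m Rm X Z) W
     + A 2%N * (ric Y Z * dot X W) + A 3%N * (ric X Z * dot Y W)
     + A 4%N * (ric X Y * dot Z W) + A 5%N * (ric X W * dot Y Z)
     + A 6%N * (ric Y W * dot X Z) + A 7%N * (ric Z W * dot X Y)
     + scal * (A 8%N * (dot X W * dot Y Z) + A 9%N * (dot X Z * dot Y W)
               + A 10%N * (dot X Y * dot Z W)) = 0) ->
  forall k, (k < 11)%N -> A k = 0.
Proof.
move=> h0 B0.
have [e [he e0]] := exists_horizontal (lt0r_neq0 h0).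
have ee := ca_pos ca e0; have [eU eV] := he.
have hK : horizontal (e *m K) by rewrite (dotKU ca) (dotKV ca).
have [KU KV] := hK; have UV := ca_UV ca; have VU := dotVU ca.
have eK : dot e (e *m K) = 0 by have := K_skew ca e e; rewrite (ca_sym ca); lra.
have Ke : dot (e *m K) e = 0 by rewrite (ca_sym ca).
have Ue : dot U e = 0 by rewrite (ca_sym ca).
have Ve : dot V e = 0 by rewrite (ca_sym ca).
have UK : dot U (e *m K) = 0 by rewrite (ca_sym ca).
have VK : dot V (e *m K) = 0 by rewrite (ca_sym ca).
have [A0 A1] : A 0%N = 0 /\ A 1%N = 0.
  have := B0 e (e *m K) U V; have := B0 e U (e *m K) V.
  rewrite Rm_e_Ke // Rm_e_U // !(eK, eU, eV, KU, KV, Ue, UV, UK) !mulr0 !addr0 => E1 E2.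
  have E1' : (A 0%N + 2 * A 1%N) * dot e e = 0 by lra.
  have E2' : (2 * A 0%N + A 1%N) * dot e e = 0 by lra.
  move: E1' E2' => /eqP; rewrite mulf_eq0 (gt_eqF ee) orbF => /eqP E1' /eqP.
  by rewrite mulf_eq0 (gt_eqF ee) orbF => /eqP E2'; split; lra.
(* For orthogonal [x] and [y], each of the three ways to fill the four slots by two copies of each
   leaves two Ricci coefficients and one scalar coefficient. The three choices of pair give a linear
   system whose differences are $(h+4)a=(h+4)b=0$. *)
have triple (a b c : R) :
    (forall x y, dot x y = 0 -> dot y x = 0 ->
       a * (ric y y * dot x x) + b * (ric x x * dot y y) + scal * (c * (dot x x * dot y y)) = 0) ->
    [/\ a = 0, b = 0 & c = 0].
  move=> abc; have := abc _ _ UV VU; have := abc _ _ Ue eU; have := abc _ _ eU Ue.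
  rewrite !ricUU !ricVV (ca_UU ca) (ca_VV ca) !(ric_horizontal he he) scalE.
  move: h0 ee; move: (h) (dot e e) => k n k0 n0 E1 E2 E3.
  have {}E1 : n * (a * k + b * -4 - 2 * k * c) = 0 by rewrite -[RHS]E1; ring.
  have {}E2 : n * (a * -4 + b * k - 2 * k * c) = 0 by rewrite -[RHS]E2; ring.
  have {}E3 : a * k + b * k - 2 * k * c = 0 by rewrite -[RHS]E3; ring.
  move/eqP: E1; rewrite mulf_eq0 gt_eqF //= => /eqP E1.
  move/eqP: E2; rewrite mulf_eq0 gt_eqF //= => /eqP E2.
  have k4 : k + 4 != 0 by rewrite gt_eqF //; lra.
  have b0 : b = 0 by apply: (mulIf k4); rewrite mul0r; lra.
  have a0 : a = 0 by apply: (mulIf k4); rewrite mul0r; lra.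
  split=> //; apply: (mulIf (lt0r_neq0 k0)); rewrite a0 b0 in E3; lra.
have [a2 a5 a8] : [/\ A 2%N = 0, A 5%N = 0 & A 8%N = 0].
  apply: triple => x y xy yx; have := B0 x y y x.
  by rewrite A0 A1 !xy ?yx => <-; ring.
have [a3 a6 a9] : [/\ A 6%N = 0, A 3%N = 0 & A 9%N = 0].
  (* In this filling [A 6] multiplies [ric y y] and [A 3] multiplies [ric x x], hence the order of
     the conclusions; likewise for [A 7] and [A 4] below. *)
  apply: triple => x y xy yx; have := B0 x y x y.
  by rewrite A0 A1 !xy ?yx => <-; ring.
have [a4 a7 a10] : [/\ A 7%N = 0, A 4%N = 0 & A 10%N = 0].
  apply: triple => x y xy yx; have := B0 x x y y.
  by rewrite A0 A1 !xy ?yx => <-; ring.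
by do 11?[case=> //].
Qed.

End Curvature.
End CurvatureAlgebra.

(** * Covariant derivatives in a chart *)

Section Entries.
Context {R : realFieldType} {m n : nat}.
Implicit Types A B : 'M[R]_(m, n).
Lemma mxaddE A B i j : (A + B) i j = A i j + B i j. Proof. by rewrite mxE. Qed.
Lemma mxoppE A i j : (- A) i j = - A i j. Proof. by rewrite mxE. Qed.
Lemma mxscaleE k A i j : (k *: A) i j = k * A i j. Proof. by rewrite mxE. Qed.
Definition entryE := (mxaddE, mxoppE, mxscaleE).
End Entries.

Section Covariant.
Context {R : realType} {n : nat}.
Local Notation m := (n + n)%N.
Local Notation E := 'rV[R]_m.
Local Notation vf := (E -> E).
Variables (O : set E) (g : E -> 'M[R]_m) (nabla : vf -> vf -> vf).
Hypotheses (O_open : open O) (lc : levi_civita O g nabla) (g_smooth : smooth_on O g).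
Implicit Types (x z w y a b : E) (X Y Z W : vf) (F : E -> 'M[R]_m) (f : E -> R).
Local Notation Gam := (Gam nabla).
Local Notation Rm := (Rm nabla).
Local Notation sGam := (smooth_Gam O_open lc).

(** Unlike [nabla], whose laws concern smooth fields, these take the direction as a vector and can
    be differentiated term by term with the matrix rules. *)
Definition covV x X y : E := 'D_x X y + X y *m Gam x y.
Definition covE x F y : 'M[R]_m := 'D_x F y + F y *m Gam x y - Gam x y *m F y.

Lemma smooth_vecmul X F : smooth_on O X -> smooth_on O F -> smooth_on O (fun q => X q *m F q).
Proof. exact: smooth_mulmx. Qed.

Lemma smooth_cstmul a F : smooth_on O F -> smooth_on O (fun q => a *m F q).
Proof. by move=> sF; apply: (smooth_mulmx O_open _ sF); exact: smooth_cst. Qed.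

Lemma smooth_covE x F : smooth_on O F -> smooth_on O (covE x F).
Proof.
move=> sF; apply: (smooth_add O_open).
  apply: (smooth_add O_open); first exact: smooth_derive.
  exact: (smooth_mulmx O_open sF (sGam x)).
apply: (smooth_opp O_open); exact: (smooth_mulmx O_open (sGam x) sF).
Qed.

Lemma smooth_mxform X Y : smooth_on O X -> smooth_on O Y ->
  smooth_on O (fun q => mxform (g q) (X q) (Y q)).
Proof.
move=> sX sY; apply: (smooth_entry O_open).
by apply: (smooth_mulmx O_open); [exact: smooth_mulmx|exact: smooth_trmx].
Qed.

Section At.
Variables (y : E) (Oy : O y).

Lemma covV_eq x X Y : (forall q, O q -> X q = Y q) -> covV x X y = covV x Y y.
Proof. by move=> XY; rewrite /covV (derive_eq_on O_open x XY Oy) (XY _ Oy). Qed.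

Lemma covV_cst x a : covV x (fun=> a) y = a *m Gam x y.
Proof. by rewrite /covV derive_const add0r. Qed.

Lemma covV_add x X Y : smooth_on O X -> smooth_on O Y ->
  covV x (fun q => X q + Y q) y = covV x X y + covV x Y y.
Proof. by move=> sX sY; rewrite /covV (derive_add Oy x sX sY) mulmxDl addrACA. Qed.

Lemma covV_opp x X : smooth_on O X -> covV x (fun q => - X q) y = - covV x X y.
Proof. by move=> sX; rewrite /covV (derive_opp Oy x sX) mulNmx opprD. Qed.

Lemma covV_scale x f X : smooth_on O f -> smooth_on O X ->
  covV x (fun q => f q *: X q) y = 'D_x f y *: X y + f y *: covV x X y.
Proof.
by move=> sf sX; rewrite /covV (derive_scale Oy x sf sX) -scalemxAl scalerDr addrA.
Qed.

Lemma covV_mul x X F : smooth_on O X -> smooth_on O F ->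
  covV x (fun q => X q *m F q) y = covV x X y *m F y + X y *m covE x F y.
Proof.
move=> sX sF; rewrite /covV /covE (derive_mulmx Oy x sX sF) !mulmxDl !(mulmxDr, mulmxN) !mulmxA.
by apply/matrixP => i j; rewrite !entryE; ring.
Qed.

Lemma metric_cov x X Y : smooth_on O X -> smooth_on O Y ->
  'D_x (fun q => mxform (g q) (X q) (Y q)) y =
  mxform (g y) (covV x X y) (Y y) + mxform (g y) (X y) (covV x Y y).
Proof.
move=> sX sY; rewrite /mxform.
have sXg : smooth_on O (fun q => X q *m g q) by exact: smooth_vecmul.
have sYt : smooth_on O (fun q => (Y q)^T) by exact: smooth_trmx.
have sP : smooth_on O (fun q => X q *m g q *m (Y q)^T) by exact: (smooth_mulmx O_open sXg sYt).
rewrite (derive_entry Oy x 0 0 sP) (derive_mulmx Oy x sXg sYt) (derive_mulmx Oy x sX g_smooth).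
rewrite (derive_trmx Oy x sY) (metric_Gam O_open lc g_smooth) // /covV.
rewrite !(mulmxDl, mulmxDr) linearD /= !(mulmxDl, mulmxDr) trmx_mul !mulmxA.
by rewrite !entryE; ring.
Qed.

Lemma covV_dirD X x z : smooth_on O X -> covV (x + z) X y = covV x X y + covV z X y.
Proof.
by move=> sX; rewrite /covV (derive_dirD Oy x z sX) (Gam_add O_open lc) // mulmxDr addrACA.
Qed.

Lemma covE_dirD F x z : smooth_on O F -> covE (x + z) F y = covE x F y + covE z F y.
Proof.
move=> sF; rewrite /covE (derive_dirD Oy x z sF) (Gam_add O_open lc) // mulmxDr mulmxDl.
move: ('D_x F y) ('D_z F y) (Gam x y) (Gam z y) (F y) => A B C D' F'.
by apply/matrixP => i j; rewrite !entryE; ring.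
Qed.

Lemma covE_dirZ F k x : smooth_on O F -> covE (k *: x) F y = k *: covE x F y.
Proof.
move=> sF; rewrite /covE (derive_dirZ Oy k x sF) (Gam_scale O_open lc) //.
by rewrite -scalemxAr -scalemxAl -scalerDr -scalerBr.
Qed.

(** No bracket term occurs because the directions are constant; the second derivatives of [X] cancel
    by symmetry. *)
Lemma ricci_identity x z X : smooth_on O X ->
  covV x (covV z X) y - covV z (covV x X) y = X y *m Rm x z y.
Proof.
move=> sX.
have N a b : covV a (covV b X) y = 'D_a ('D_b X) y + 'D_a X y *m Gam b y + X y *m 'D_a (Gam b) y
    + 'D_b X y *m Gam a y + X y *m Gam b y *m Gam a y.
  rewrite /covV.
  rewrite (derive_add Oy a (smooth_derive b sX) (smooth_vecmul sX (sGam b))).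
  by rewrite (derive_mulmx Oy a sX (sGam b)) mulmxDl !addrA.
rewrite !N /Rm !(mulmxDr, mulmxN) !mulmxA.
move: ('D_x X y) ('D_z X y) ('D_x ('D_z X) y) ('D_z ('D_x X) y) (derive_comm O_open x z sX Oy).
move: ('D_x (Gam z) y) ('D_z (Gam x) y) (Gam x y) (Gam z y) (X y) => A B C D' X' x1 z1 xz _ <-.
by apply/matrixP => i j; rewrite !entryE; ring.
Qed.

End At.
End Covariant.

(** * Symmetries of the curvature tensor *)

Section CurvatureIdentities.
Context {R : realType} {n : nat}.
Local Notation m := (n + n)%N.
Local Notation E := 'rV[R]_m.
Local Notation vf := (E -> E).
Variables (O : set E) (g : E -> 'M[R]_m) (nabla : vf -> vf -> vf).
Hypotheses (O_open : open O) (lc : levi_civita O g nabla) (g_smooth : smooth_on O g).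
Implicit Types (x z w y a b : E).
Local Notation Gam := (Gam nabla).
Local Notation Rm := (Rm nabla).
Local Notation covV := (covV nabla).
Local Notation sGam := (smooth_Gam O_open lc).
Variables (y : E) (Oy : O y).

Lemma Rm_anti x z : Rm x z y = - Rm z x y.
Proof.
rewrite /Rm; move: ('D_x (Gam z) y) ('D_z (Gam x) y) => A B.
by apply/matrixP => i j; rewrite !entryE; ring.
Qed.

Lemma smooth_covV_cst x a : smooth_on O (fun q => a *m Gam x q).
Proof. exact: (smooth_cstmul O_open a (sGam x)). Qed.

Lemma mulmx_Rm x z w :
  w *m Rm x z y = covV x (fun q => w *m Gam z q) y - covV z (fun q => w *m Gam x q) y.
Proof.
rewrite -(ricci_identity O_open lc Oy x z (smooth_cst w)).
by congr (_ - _); apply: (covV_eq _ O_open Oy) => q Oq; rewrite covV_cst.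
Qed.

Lemma covV_Gam_sym x z w :
  covV x (fun q => w *m Gam z q) y = covV x (fun q => z *m Gam w q) y.
Proof. by apply: (covV_eq _ O_open Oy) => q Oq; exact: (torsion_Gam O_open lc). Qed.

Lemma bianchi x z w : w *m Rm x z y + x *m Rm z w y + z *m Rm w x y = 0.
Proof.
rewrite !mulmx_Rm (covV_Gam_sym x z w) (covV_Gam_sym w z x) (covV_Gam_sym z x w).
move: (covV x _ y) (covV z _ y) (covV w _ y) => A B C.
by apply/matrixP => i j; rewrite !entryE [RHS]mxE; ring.
Qed.

Lemma Rm_addr x z w : Rm x (z + w) y = Rm x z y + Rm x w y.
Proof.
apply/row_matrixP => i; rewrite !rowE [RHS]mulmxDr !mulmx_Rm; set a := delta_mx _ _.
rewrite (covV_dirD O_open lc Oy z w (smooth_covV_cst x a)).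
have -> : covV x (fun q => a *m Gam (z + w) q) y =
    covV x (fun q => a *m Gam z q + a *m Gam w q) y.
  by apply: (covV_eq _ O_open Oy) => q Oq; rewrite (Gam_add O_open lc) // mulmxDr.
rewrite (covV_add nabla Oy x (smooth_covV_cst z a) (smooth_covV_cst w a)).
by rewrite opprD addrACA.
Qed.

Lemma Rm_scaler k x z : Rm x (k *: z) y = k *: Rm x z y.
Proof.
apply/row_matrixP => i; rewrite !rowE -scalemxAr !mulmx_Rm; set a := delta_mx _ _.
have -> : covV (k *: z) (fun q => a *m Gam x q) y = k *: covV z (fun q => a *m Gam x q) y.
  rewrite /covV (derive_dirZ Oy k z (smooth_covV_cst x a)) (Gam_scale O_open lc) //.
  by rewrite -scalemxAr -scalerDr.
have -> : covV x (fun q => a *m Gam (k *: z) q) y = covV x (fun q => k *: (a *m Gam z q)) y.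
  by apply: (covV_eq _ O_open Oy) => q Oq; rewrite (Gam_scale O_open lc) // scalemxAr.
rewrite (covV_scale nabla Oy x (smooth_cst k) (smooth_covV_cst z a)).
by rewrite derive_const scale0r add0r -scalerBr.
Qed.

(** Commuting second derivatives of the function $g(a,b)$: the products of two first derivatives are
    symmetric in [x] and [z] and drop out, leaving the two curvature terms. *)
Lemma Rm_skew x z a b :
  mxform (g y) (a *m Rm x z y) b = - mxform (g y) a (b *m Rm x z y).
Proof.
have sab w : smooth_on O (fun q => mxform (g q) (a *m Gam w q) b).
  by apply: (smooth_mxform O_open g_smooth); [exact: smooth_covV_cst|exact: smooth_cst].
have sba w : smooth_on O (fun q => mxform (g q) a (b *m Gam w q)).
  by apply: (smooth_mxform O_open g_smooth); [exact: smooth_cst|exact: smooth_covV_cst].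
have D1 w q : O q -> 'D_w (fun q => mxform (g q) a b) q =
    mxform (g q) (a *m Gam w q) b + mxform (g q) a (b *m Gam w q).
  move=> Oq; rewrite (metric_cov O_open lc g_smooth Oq w (smooth_cst a) (smooth_cst b)).
  by rewrite !covV_cst.
have D2 w w' : 'D_w ('D_w' (fun q => mxform (g q) a b)) y =
    mxform (g y) (covV w (fun q => a *m Gam w' q) y) b + mxform (g y) (a *m Gam w' y) (b *m Gam w y)
    + (mxform (g y) (a *m Gam w y) (b *m Gam w' y) + mxform (g y) a (covV w (fun q => b *m Gam w' q) y)).
  rewrite (derive_eq_on O_open w (D1 w') Oy) (derive_add Oy w (sab w') (sba w')).
  rewrite (metric_cov O_open lc g_smooth Oy w (smooth_covV_cst w' a) (smooth_cst b)).
  rewrite (metric_cov O_open lc g_smooth Oy w (smooth_cst a) (smooth_covV_cst w' b)).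
  by rewrite !covV_cst.
have sg : smooth_on O (fun q => mxform (g q) a b).
  by apply: (smooth_mxform O_open g_smooth); exact: smooth_cst.
have := etrans (esym (D2 x z)) (etrans (derive_comm_scalar O_open x z sg Oy) (D2 z x)).
rewrite !mulmx_Rm.
move: (covV x (fun q => a *m Gam z q) y) (covV z (fun q => a *m Gam x q) y) => A B.
move: (covV x (fun q => b *m Gam z q) y) (covV z (fun q => b *m Gam x q) y) => C D'.
by move: (Gam x y) (Gam z y) (g y) => Gx Gz gy E12; rewrite !mxformE; clear -E12; lra.
Qed.

End CurvatureIdentities.

(** * Normal contact structures in a chart *)

Section LocalContact.
Context {R : realType} {n : nat}.
Local Notation m := (n + n)%N.
Local Notation E := 'rV[R]_m.
Local Notation vf := (E -> E).
Variables (O : set E) (g : E -> 'M[R]_m) (nabla : vf -> vf -> vf).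
Hypotheses (O_open : open O) (lc : levi_civita O g nabla) (g_smooth : smooth_on O g).
Implicit Types (x z w y a b : E).
Local Notation Gam := (Gam nabla).
Local Notation Rm := (Rm nabla).
Local Notation covV := (covV nabla).
Local Notation covE := (covE nabla).

(** The fields on [nabla_x U] and [nabla_x G] express only the tensor [S]; for [T] the record is
    also used with [(H, - G, V, - U)]. *)
Record local_contact (G H : E -> 'M[R]_m) (U V : vf) : Prop := LocalContact {
  lk_alg : forall y, O y -> contact_alg (g y) (G y) (H y) (U y) (V y);
  lk_sG : smooth_on O G;
  lk_sH : smooth_on O H;
  lk_sU : smooth_on O U;
  lk_sV : smooth_on O V;
  lk_dU : forall x z y, O y -> 2 * mxform (g y) x (z *m G y) =
    'D_x (fun q => mxform (g q) z (U q)) y - 'D_z (fun q => mxform (g q) x (U q)) y;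
  lk_dV : forall x z y, O y -> 2 * mxform (g y) x (z *m H y) =
    'D_x (fun q => mxform (g q) z (V q)) y - 'D_z (fun q => mxform (g q) x (V q)) y;
  lk_normalU : forall x y, O y ->
    normality (g y) (G y) (H y) (U y) (V y) (fun w => covV w U y) (fun w => covE w G y) x (U y) = 0;
  lk_normalH : forall x z y, O y ->
    mxform (g y) x (U y) = 0 /\ mxform (g y) x (V y) = 0 ->
    mxform (g y) z (U y) = 0 /\ mxform (g y) z (V y) = 0 ->
    normality (g y) (G y) (H y) (U y) (V y) (fun w => covV w U y) (fun w => covE w G y) x z = 0 }.

Section Jet.
Variables (G H : E -> 'M[R]_m) (U V : vf).
Hypothesis lk : local_contact G H U V.
Let sG := lk_sG lk.
Let sU := lk_sU lk.
Let sV := lk_sV lk.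
Variables (y : E) (Oy : O y).
Local Notation dot := (mxform (g y)).
Let ca := lk_alg lk Oy.

Lemma metric_cov_const x X Y (c : R) : smooth_on O X -> smooth_on O Y ->
  (forall q, O q -> mxform (g q) (X q) (Y q) = c) ->
  dot (covV x X y) (Y y) = - dot (X y) (covV x Y y).
Proof.
move=> sX sY XYc; have := metric_cov O_open lc g_smooth Oy x sX sY.
rewrite (derive_eq_on O_open (h := fun=> c) x XYc Oy) derive_const => /esym/eqP.
by rewrite addr_eq0 => /eqP.
Qed.

Lemma derive_pairing x a X : smooth_on O X ->
  'D_x (fun q => mxform (g q) a (X q)) y = dot (a *m Gam x y) (X y) + dot a (covV x X y).
Proof.
by move=> sX; rewrite (metric_cov O_open lc g_smooth Oy x (smooth_cst a) sX) covV_cst.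
Qed.

Lemma d_pairing x z X : smooth_on O X ->
  'D_x (fun q => mxform (g q) z (X q)) y - 'D_z (fun q => mxform (g q) x (X q)) y =
  dot (covV x X y) z - dot (covV z X y) x.
Proof.
move=> sX; rewrite !derive_pairing // (torsion_Gam O_open lc x z Oy).
rewrite !(ca_sym ca (covV _ _ _)).
by move: (dot _ _) (dot z _) (dot x _) => A B C; ring.
Qed.

Lemma covV_kernel x X : smooth_on O X -> (forall q, O q -> X q *m G q = 0) ->
  X y *m covE x G y = - (covV x X y *m G y).
Proof.
move=> sX XG; have := covV_mul nabla Oy x sX sG.
rewrite (covV_eq nabla O_open Oy x (Y := fun=> 0) XG) covV_cst mul0mx => /esym/eqP.
by rewrite addrC addr_eq0 => /eqP.
Qed.

Lemma sGa a : smooth_on O (fun q => a *m G q).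
Proof. exact: smooth_cstmul. Qed.

Lemma covV_aG x a : covV x (fun q => a *m G q) y = a *m Gam x y *m G y + a *m covE x G y.
Proof. by rewrite (covV_mul nabla Oy x (smooth_cst a) sG) covV_cst. Qed.

Lemma covE_skew x a b : dot (a *m covE x G y) b = - dot a (b *m covE x G y).
Proof.
have sab : smooth_on O (fun q => mxform (g q) (a *m G q) b).
  by apply: (smooth_mxform O_open g_smooth); [exact: sGa|exact: smooth_cst].
have sba : smooth_on O (fun q => mxform (g q) (b *m G q) a).
  by apply: (smooth_mxform O_open g_smooth); [exact: sGa|exact: smooth_cst].
have z0 q : O q -> mxform (g q) (a *m G q) b + mxform (g q) (b *m G q) a = 0.
  by move=> Oq; rewrite (ca_Gskew (lk_alg lk Oq) b) (ca_sym (lk_alg lk Oq)) addrC addNr.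
have := derive_add Oy x sab sba.
rewrite (derive_eq_on O_open x z0 Oy) derive_const.
rewrite (metric_cov O_open lc g_smooth Oy x (sGa a) (smooth_cst b)).
rewrite (metric_cov O_open lc g_smooth Oy x (sGa b) (smooth_cst a)).
rewrite !covV_cst !covV_aG; move: (covE x G y) (Gam x y) => D Gx; rewrite !mxformDl.
rewrite (ca_Gskew ca (a *m Gx)) (ca_Gskew ca (b *m Gx)).
by rewrite (ca_sym ca (b *m G y)) (ca_sym ca (a *m G y)) (ca_sym ca (b *m D)) => E0; lra.
Qed.

Lemma covE_square x a : a *m G y *m covE x G y + a *m covE x G y *m G y =
  dot a (covV x U y) *: U y + dot a (U y) *: covV x U y
  + dot a (covV x V y) *: V y + dot a (V y) *: covV x V y.
Proof.
have sp X : smooth_on O X -> smooth_on O (fun q => mxform (g q) a (X q)).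
  by move=> sX; apply: (smooth_mxform O_open g_smooth) => //; exact: smooth_cst.
have := covV_mul nabla Oy x (sGa a) sG; rewrite covV_aG.
have GGa q : O q -> a *m G q *m G q =
    - a + mxform (g q) a (U q) *: U q + mxform (g q) a (V q) *: V q.
  by move=> Oq; exact: (ca_GG (lk_alg lk Oq)).
rewrite (covV_eq nabla O_open Oy x GGa).
have sUU := smooth_scale O_open (sp _ sU) sU; have sVV := smooth_scale O_open (sp _ sV) sV.
have saU := smooth_add O_open (smooth_cst (- a)) sUU.
rewrite (covV_add nabla Oy x saU sVV) (covV_add nabla Oy x (smooth_cst (- a)) sUU) covV_cst.
rewrite (covV_scale nabla Oy x (sp _ sU) sU) (covV_scale nabla Oy x (sp _ sV) sV).
rewrite !derive_pairing //; move: (covE x G y) (Gam x y) (covV x U y) (covV x V y) => D Gx u v.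
rewrite mulmxDl (ca_GG ca (a *m Gx)) mulNmx !scalerDl => E1.
apply/matrixP => i j; have := congr1 (fun M : E => M i j) E1; rewrite !entryE; lra.
Qed.

(** This is $d(du)=0$: the equation for $du$ is differentiated once and summed cyclically, and the
    Christoffel terms cancel by vanishing torsion and skewness of $G$. *)
Lemma covE_closed x z w :
  dot (z *m covE x G y) w + dot (w *m covE z G y) x + dot (x *m covE w G y) z = 0.
Proof.
have sp a X : smooth_on O X -> smooth_on O (fun q => mxform (g q) a (X q)).
  by move=> sX; apply: (smooth_mxform O_open g_smooth) => //; exact: smooth_cst.
have DO a b c : 'D_c (fun q => mxform (g q) a (b *m G q)) y =
    dot (a *m Gam c y) (b *m G y) + dot a (b *m Gam c y *m G y + b *m covE c G y).
  by rewrite derive_pairing ?covV_aG //; exact: sGa.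
have DD a b c : 2 * 'D_c (fun q => mxform (g q) a (b *m G q)) y =
    'D_c ('D_a (fun q => mxform (g q) b (U q))) y - 'D_c ('D_b (fun q => mxform (g q) a (U q))) y.
  have s1 := smooth_derive a (sp b _ sU); have s2 := smooth_derive b (sp a _ sU).
  rewrite -(derive_opp Oy c s2) -(derive_add Oy c s1 (smooth_opp O_open s2)).
  rewrite -(derive_eq_on O_open c (fun q => lk_dU lk a b (y := q)) Oy).
  have sab : smooth_on O (fun q => mxform (g q) a (b *m G q)) by exact/sp/sGa.
  have [_ /(_ c)] := derive_bilinear_mul (differentiable_cst (2 : R) y) (smooth_differentiable sab Oy).
  by rewrite derive_cst mul0r add0r => ->.
have C a b c : 'D_a ('D_b (fun q => mxform (g q) c (U q))) y = 'D_b ('D_a (fun q => mxform (g q) c (U q))) y.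
  exact: (derive_comm_scalar O_open a b (sp c _ sU) Oy).
(* [P a b c] is the second derivative of $u(c)$ along [a] and [b]. Hiding it behind its symmetry
   leaves a linear problem. *)
have {DD DO C} [P [PC PD]] : exists P : E -> E -> E -> R, (forall a b c, P a b c = P b a c) /\
    forall a b c, 2 * (dot (a *m Gam c y) (b *m G y)
      + dot a (b *m Gam c y *m G y + b *m covE c G y)) = P c a b - P c b a.
  exists (fun a b c => 'D_a ('D_b (fun q => mxform (g q) c (U q))) y).
  by split=> [a b c|a b c]; [exact: C|rewrite -(DO a b c); exact: DD].
rewrite !covE_skew; have := PD z w x; have := PD w x z; have := PD x z w.
rewrite (PC x z) (PC x w) (PC z w).
rewrite (torsion_Gam O_open lc x z Oy) (torsion_Gam O_open lc x w Oy) (torsion_Gam O_open lc z w Oy).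
move: (covE x G y) (covE z G y) (covE w G y) (Gam x y) (Gam z y) (Gam w y) => Dx Dz Dw Gx Gz Gw.
rewrite !mxformDr.
have sk a b : dot a (b *m G y) = - dot b (a *m G y).
  by rewrite (ca_sym ca) (ca_Gskew ca).
rewrite (sk x) (sk w (x *m Gz)) (sk z (x *m Gw)) => E1 E2 E3; lra.
Qed.

Lemma local_normal_jet : normal_jet (g y) (G y) (H y) (U y) (V y)
  (fun w => covV w U y) (fun w => covV w V y) (fun w => covE w G y).
Proof.
have cU X Y (c : R) : smooth_on O X -> smooth_on O Y ->
    (forall q, O q -> mxform (g q) (X q) (Y q) = c) ->
    forall x, dot (covV x X y) (Y y) = - dot (covV x Y y) (X y).
  by move=> sX sY XY x; rewrite (metric_cov_const x sX sY XY) (ca_sym ca).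
split.
- by move=> x z; exact: (covE_dirD O_open lc Oy x z sG).
- by move=> k x; exact: (covE_dirZ O_open lc Oy k x sG).
- by move=> x; have := cU U U 1 sU sU (fun q Oq => ca_UU (lk_alg lk Oq)) x; lra.
- by move=> x; have := cU V V 1 sV sV (fun q Oq => ca_VV (lk_alg lk Oq)) x; lra.
- exact: (cU U V 0 sU sV (fun q Oq => ca_UV (lk_alg lk Oq))).
- by move=> x z; rewrite (lk_dU lk x z Oy) d_pairing.
- by move=> x z; rewrite (lk_dV lk x z Oy) d_pairing.
- by move=> x; apply: covV_kernel => // q Oq; exact: (ca_UG (lk_alg lk Oq)).
- by move=> x; apply: covV_kernel => // q Oq; exact: (ca_VG (lk_alg lk Oq)).
- exact: covE_skew.
- exact: covE_square.
- exact: covE_closed.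
- by move=> x; exact: (lk_normalU lk x Oy).
- by move=> x z; exact: (lk_normalH lk Oy).
Qed.

Lemma covV_U x : covV x U y = - (x *m G y).
Proof. exact: (nU_G ca local_normal_jet). Qed.

End Jet.
End LocalContact.

(** * Curvature of a complex Sasakian chart *)

Section LocalSasakian.
Context {R : realType} {n : nat}.
Local Notation m := (n + n)%N.
Local Notation E := 'rV[R]_m.
Local Notation vf := (E -> E).
Variables (O : set E) (g : E -> 'M[R]_m) (nabla : vf -> vf -> vf).
Hypotheses (O_open : open O) (lc : levi_civita O g nabla) (g_smooth : smooth_on O g).
Implicit Types (x z w y a b t : E).
Local Notation Gam := (Gam nabla).
Local Notation Rm := (Rm nabla).
Local Notation covV := (covV nabla).
Local Notation covE := (covE nabla).

Section Formulas.
Variables (G H : E -> 'M[R]_m) (U V : vf).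
Hypotheses (lk : local_contact O g nabla G H U V)
  (covV_V : forall x y, O y -> covV x V y = - (x *m H y)).
Let sG := lk_sG lk.
Let sH := lk_sH lk.
Let sU := lk_sU lk.
Let sV := lk_sV lk.
Variables (y : E) (Oy : O y).
Local Notation dot := (mxform (g y)).
Local Notation horizontal x := (dot x (U y) = 0 /\ dot x (V y) = 0).
Let ca := lk_alg lk Oy.

Lemma mulmx_covE z w q : O q ->
  w *m covE z G q = cov_formula (g q) (G q) (H q) (U q) (V q) z w.
Proof.
move=> Oq; exact: (D_formula (lk_alg lk Oq) (local_normal_jet O_open lc g_smooth lk Oq)
  (fun x => covV_V x Oq)).
Qed.

Lemma mulmx_Rm_U x z : U y *m Rm x z y =
  cov_formula (g y) (G y) (H y) (U y) (V y) z x - cov_formula (g y) (G y) (H y) (U y) (V y) x z.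
Proof.
rewrite -(ricci_identity O_open lc Oy x z sU) -!mulmx_covE //.
have cUz w v : covV v (covV w U) y = - (w *m Gam v y *m G y + w *m covE v G y).
  rewrite (covV_eq nabla O_open Oy v (Y := fun q => - (w *m G q))); last first.
    by move=> q Oq; exact: (covV_U O_open lc g_smooth lk Oq).
  rewrite (covV_opp nabla Oy v (smooth_cstmul O_open w sG)).
  by rewrite (covV_mul nabla Oy v (smooth_cst w) sG) covV_cst.
rewrite !cUz (torsion_Gam O_open lc x z Oy).
move: (_ *m G y) (x *m covE z G y) (z *m covE x G y) => A B C.
by apply/matrixP => i j; rewrite !entryE; ring.
Qed.

(** The Ricci identity for the field $Gw$ minus the image under $G$ of the one for [w]; only
    derivatives of $\nabla G$ remain. *)
Lemma mulmx_commutator x z w : w *m (G y *m Rm x z y - Rm x z y *m G y) =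
  (covV x (fun q => w *m covE z G q) y - w *m Gam x y *m covE z G y)
  - (covV z (fun q => w *m covE x G q) y - w *m Gam z y *m covE x G y).
Proof.
have sGw := smooth_cstmul O_open w sG.
have sC v : smooth_on O (fun q => w *m covE v G q).
  by apply: (smooth_cstmul O_open); exact: (smooth_covE O_open lc v sG).
have sGam v := smooth_covV_cst O_open lc v w.
have cov2 a b : covV a (covV b (fun q => w *m G q)) y =
    covV a (fun q => w *m Gam b q) y *m G y + w *m Gam b y *m covE a G y
    + covV a (fun q => w *m covE b G q) y.
  rewrite (covV_eq nabla O_open Oy a (Y := fun q => w *m Gam b q *m G q + w *m covE b G q)); last first.
    by move=> q Oq; rewrite (covV_mul nabla Oq b (smooth_cst w) sG) covV_cst.
  rewrite (covV_add nabla Oy a (smooth_vecmul O_open (sGam b) sG) (sC b)).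
  by rewrite (covV_mul nabla Oy a (sGam b) sG).
have E1 := ricci_identity O_open lc Oy x z sGw.
have E2 := mulmx_Rm O_open lc Oy x z w.
rewrite [LHS]mulmxBr !mulmxA -E1 E2 !cov2 [X in _ - X]mulmxBl.
move: (covV x (fun q => w *m covE z G q) y) (covV z (fun q => w *m covE x G q) y) => A B.
move: (covV x (fun q => w *m Gam z q) y) (covV z (fun q => w *m Gam x q) y) => C D'.
move: (covE z G y) (covE x G y) (Gam x y) (Gam z y) => K L Gx Gz.
by apply/matrixP => i j; rewrite !entryE; ring.
Qed.

(** Differentiates [cov_formula]. The constant field [z] is neither parallel nor horizontal away
    from [y], so the missing correction $\nabla_{\nabla_xz}G$ of the second covariant derivative
    shows up as the last term. *)
Lemma covV_formula x z w t : horizontal z -> horizontal w -> horizontal t ->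
  dot (covV x (fun q => w *m covE z G q) y - w *m Gam x y *m covE z G y) t =
  cov2_formula (g y) (G y) (H y) x z w t - 2 * dot (z *m Gam x y) (V y) * dot (w *m (G y *m H y)) t.
Proof.
move=> [zU zV] [wU wV] [tU tV].
rewrite (covV_eq nabla O_open Oy x (fun q Oq => mulmx_covE z w Oq)).
pose sc (X Y : vf) := fun q : E => mxform (g q) (X q) (Y q).
have smx (X Y : vf) : smooth_on O X -> smooth_on O Y -> smooth_on O (sc X Y).
  exact: smooth_mxform.
have sK a : smooth_on O (fun q => a *m (G q *m H q)).
  by apply: (smooth_cstmul O_open); exact: (smooth_mulmx O_open sG sH).
have sGG a : smooth_on O (fun q => a *m G q *m G q).
  exact: (smooth_vecmul O_open (smooth_cstmul O_open a sG) sG).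
have sa a : smooth_on O (fun=> a : E) by exact: smooth_cst.
have sterm (k : R) (f : E -> R) (X : vf) : smooth_on O f -> smooth_on O X -> smooth_on O (fun q => k *: (f q *: X q)).
  move=> sf sX; apply: (smooth_scale O_open (smooth_cst k)); exact: (smooth_scale O_open sf sX).
have covT (k : R) (f : E -> R) (X : vf) : smooth_on O f -> smooth_on O X ->
    covV x (fun q => k *: (f q *: X q)) y = k *: ('D_x f y *: X y + f y *: covV x X y).
  move=> sf sX; rewrite (covV_scale nabla Oy x (smooth_cst k) (smooth_scale O_open sf sX)).
  by rewrite derive_const scale0r add0r (covV_scale nabla Oy x sf sX).
have -> : covV x (fun q => cov_formula (g q) (G q) (H q) (U q) (V q) z w) y =
    covV x (fun q => - 2 *: (sc (fun=> z) V q *: (w *m (G q *m H q)))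
      + 1 *: (sc (fun=> w) U q *: (z *m G q *m G q))
      + - 1 *: (sc (fun=> w) V q *: (z *m (G q *m H q)))
      + - 1 *: (sc (fun q => z *m G q *m G q) (fun=> w) q *: U q)
      + 1 *: (sc (fun q => z *m (G q *m H q)) (fun=> w) q *: V q)) y.
  by apply: (covV_eq nabla O_open Oy) => q Oq; rewrite /cov_formula /sc !scale1r !scaleN1r scalerA.
have s1 := sterm (- 2) _ _ (smx _ _ (sa z) sV) (sK w).
have s2 := sterm 1 _ _ (smx _ _ (sa w) sU) (sGG z).
have s3 := sterm (- 1) _ _ (smx _ _ (sa w) sV) (sK z).
have s4 := sterm (- 1) _ _ (smx _ _ (sGG z) (sa w)) sU.
have s5 := sterm 1 _ _ (smx _ _ (sK z) (sa w)) sV.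
have s12 := smooth_add O_open s1 s2; have s123 := smooth_add O_open s12 s3.
have s1234 := smooth_add O_open s123 s4.
rewrite (covV_add nabla Oy x s1234 s5) (covV_add nabla Oy x s123 s4).
rewrite (covV_add nabla Oy x s12 s3) (covV_add nabla Oy x s1 s2).
rewrite (covT _ _ _ (smx _ _ (sa z) sV) (sK w)) (covT _ _ _ (smx _ _ (sa w) sU) (sGG z)).
rewrite (covT _ _ _ (smx _ _ (sa w) sV) (sK z)) (covT _ _ _ (smx _ _ (sGG z) (sa w)) sU).
rewrite (covT _ _ _ (smx _ _ (sK z) (sa w)) sV).
have zGG : z *m G y *m G y = - z by exact: (horizontalGG ca zU zV).
rewrite /sc (covV_U O_open lc g_smooth lk Oy) covV_V // zV wU wV zGG.
rewrite !(derive_pairing O_open lc g_smooth Oy) // (covV_U O_open lc g_smooth lk Oy) covV_V //.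
rewrite mulmx_covE //.
rewrite /cov_formula zV zGG.
(* What is abstracted here has no effect: [d1] and [d2] multiply [U y] and [V y], which are
   orthogonal to [t], while [v1], [v2], [v3] carry the factors $v(z)$, $u(w)$, $v(w)$, which are
   zero. *)
move: ('D_x _ y) => d1; move: ('D_x _ y) => d2.
move: (covV x _ y) => v1; move: (covV x _ y) => v2; move: (covV x _ y) => v3.
rewrite !mxformE (ca_sym ca (U y)) (ca_sym ca (V y)) tU tV /cov2_formula.
rewrite (ca_sym ca z (x *m H y)) (ca_sym ca w (x *m G y)) (ca_sym ca w (x *m H y)).
by move: (Gam x y) (G y) (H y) => Gx Gy Hy; ring.
Qed.

(** The correction term in [covV_formula] is symmetric in [x] and [z] because the torsion vanishes,
    so it cancels. *)
Lemma mxform_commutator x z w t : horizontal x -> horizontal z -> horizontal w -> horizontal t ->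
  dot (w *m (G y *m Rm x z y - Rm x z y *m G y)) t =
  cov2_formula (g y) (G y) (H y) x z w t - cov2_formula (g y) (G y) (H y) z x w t.
Proof.
move=> hx hz hw ht; rewrite mulmx_commutator mxformDl mxformNl !covV_formula //.
by rewrite (torsion_Gam O_open lc x z Oy); ring.
Qed.

End Formulas.

Variables (G H : E -> 'M[R]_m) (U V : vf).
Hypotheses (lk : local_contact O g nabla G H U V)
  (lk' : local_contact O g nabla H (fun y => - G y) V (fun y => - U y)).

(** The formula for $\nabla U$ read in the dual structure. This is where the tensor $T$ enters, and
    it discharges the assumption under which $\nabla G$ was computed. *)
Lemma covV_V x y : O y -> covV x V y = - (x *m H y).
Proof. by move=> Oy; exact: (covV_U O_open lc g_smooth lk' Oy). Qed.

Lemma covV_dual x y : O y -> covV x (fun q => - U q) y = - (x *m (- G y)).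
Proof.
move=> Oy; rewrite (covV_opp nabla Oy x (lk_sU lk)).
by rewrite (covV_U O_open lc g_smooth lk Oy) mulmxN.
Qed.

Lemma local_curvature_jet y : O y ->
  curvature_jet (g y) (G y) (H y) (U y) (V y) (fun x z => Rm x z y).
Proof.
move=> Oy; split.
- exact: (Rm_addr O_open lc Oy).
- exact: (Rm_scaler O_open lc Oy).
- by move=> x z; exact: Rm_anti.
- by move=> x z w; exact: (bianchi O_open lc Oy).
- exact: (Rm_skew O_open lc g_smooth Oy).
- exact: (mulmx_Rm_U lk covV_V Oy).
- exact: (mulmx_Rm_U lk' covV_dual Oy).
- exact: (mxform_commutator lk covV_V Oy).
- move=> x z w t [xU xV] [zU zV] [wU wV] [tU tV].
  apply: (mxform_commutator lk' covV_dual Oy); split=> //; by rewrite mxformNr ?xU ?zU ?wU ?tU oppr0.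
Qed.
End LocalSasakian.

(** * From the manifold to a chart *)

Lemma J0J0 (R : realType) (n : nat) : (J0 : 'M[R]_(n + n)) *m J0 = - 1%:M.
Proof.
rewrite /J0 mulmx_block !(mul0mx, mulmx0, mul1mx, mulmx1, addr0, add0r).
by rewrite (scalar_mx_block _ _ 1) opp_block_mx !oppr0.
Qed.

(** The right-hand side is the shape of $T$. The role of $\sigma$ in the dual structure is played by
    $g(\nabla V,-U)$, which is $\sigma$ again. *)
Lemma normality_dual (R : realFieldType) (m : nat) (g G H : 'M[R]_m) (U V : 'rV[R]_m)
    (nU nV : 'rV[R]_m -> 'rV[R]_m) (D : 'rV[R]_m -> 'M[R]_m) (x y : 'rV[R]_m) :
  contact_alg g G H U V -> (forall w, mxform g (nV w) U = - mxform g (nU w) V) ->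
  normality g H (- G) V (- U) nV D x y =
  y *m D (x *m H) - x *m D (y *m H) - y *m D x *m H + x *m D y *m H
  - (2 * mxform g x (y *m G)) *: U + (2 * mxform g x (y *m H)) *: V
  + 2 *: (mxform g y U *: (x *m G) - mxform g x U *: (y *m G))
  + mxform g (nU (x *m H)) V *: (y *m G) - mxform g (nU (y *m H)) V *: (x *m G)
  + mxform g (nU x) V *: (y *m H *m G) - mxform g (nU y) V *: (x *m H *m G).
Proof.
move=> ca UV; rewrite /normality !(mulmxN, mulNmx) !(ca_HG ca) !mxformNr !UV !opprK.
by apply/matrixP => i j; rewrite !entryE; ring.
Qed.

Section Chart.
Context {R : realType} {p : nat} {N : complexManifold R p.*2.+1} (D : contactData N).
Local Notation n := p.*2.+1.
Local Notation m := (n + n)%N.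
Local Notation E := 'rV[R]_m.
Local Notation vf := (E -> E).
Variable c : atlas N.
Local Notation O := (cod (chart_of c)).
Local Notation g := (metric D c).
Local Notation nab := (nabla D c).
Local Notation U := (field_U D c).
Local Notation V := (field_V D c).
Local Notation G := (endo_G D c).
Local Notation H := (endo_H D c).
Local Notation u := (form_u D c).
Local Notation v := (form_v D c).
Let O_open : open O := @cod_open _ _ _ (chart_of c).
Let lc := nabla_levi_civita D c.
Let g_smooth : smooth_on O g := (metric_tensor D).1 c.
Let sU : smooth_on O U := (field_U_tensor D).1 c.
Let sV : smooth_on O V := (field_V_tensor D).1 c.
Let sG : smooth_on O G := (endo_G_tensor D).1 c.
Let sH : smooth_on O H := (endo_H_tensor D).1 c.
Local Notation covV := (covV nab).
Local Notation covE := (covE nab).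

Lemma form_uE X y : O y -> form_app u X y = mxform (g y) (X y) (U y).
Proof.
move=> Oy; have [_ _ uE _ _] := uvUV_axioms D Oy; have [gs _ _] := metric_hermitian D Oy.
by rewrite uE gs.
Qed.

Lemma form_vE X y : O y -> form_app v X y = mxform (g y) (X y) (V y).
Proof.
move=> Oy; have [_ _ _ vE _] := uvUV_axioms D Oy; have [gs _ _] := metric_hermitian D Oy.
by rewrite vE gs.
Qed.

Lemma chart_contact_alg y : O y -> contact_alg (g y) (G y) (H y) (U y) (V y).
Proof.
move=> Oy; have [gs gpos gJ] := metric_hermitian D Oy.
have [_ VE _ _ [UU VV _ vU0]] := uvUV_axioms D Oy.
have [HE GG HH GJ [UG Gs]] := GH_axioms D Oy.
have Hx (x : E) : x *m H y = x *m J0 *m G y by exact: (HE (cst x)).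
have GJx (x : E) : x *m J0 *m G y = - (x *m G y *m J0) by exact: (GJ (cst x)).
have UG0 : U y *m G y = 0 by exact: UG.
have VG0 : V y *m G y = 0.
  by rewrite VE /J /endo_app /cst mulNmx GJx UG0 mul0mx !oppr0.
have gJx (a b : E) : mxform (g y) (a *m J0) (b *m J0) = mxform (g y) a b by exact: (gJ (cst a) (cst b)).
have Gsk (a b : E) : mxform (g y) (a *m G y) b = - mxform (g y) a (b *m G y).
  by apply/eqP; rewrite -eqr_oppLR; apply/eqP; exact/esym/(Gs (cst a) (cst b)).
split.
- by move=> x z; exact: (gs (cst x) (cst z)).
- by move=> x; exact: (gpos (cst x)).
- by rewrite -form_uE.
- by rewrite -form_vE.
- by rewrite -form_vE.
- by move=> x; rewrite -(form_uE (cst x)) // -(form_vE (cst x)) //; exact: (GG (cst x)).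
- by move=> x; rewrite -(form_uE (cst x)) // -(form_vE (cst x)) //; exact: (HH (cst x)).
- by move=> x; rewrite !Hx GJx mulNmx.
- by [].
- by [].
- by rewrite Hx GJx UG0 mul0mx oppr0.
- by rewrite Hx GJx VG0 mul0mx oppr0.
- exact: Gsk.
(* $H=GJ$ is skew because $G$ and $J$ are skew and anticommute; skewness of $J$ comes from the
   Hermitian metric and $J^2=-1$. *)
- move=> a b; rewrite !Hx Gsk GJx mxformNr opprK -(gJx (a *m J0)) -[a *m J0 *m J0]mulmxA J0J0 mulmxN mulmx1.
  by rewrite mxformNl opprK.
Qed.


Lemma nabla_covV X Y y : smooth_on O X -> smooth_on O Y -> O y -> nab X Y y = covV (X y) Y y.
Proof. by move=> sX sY Oy; exact: (nablaE O_open lc sX sY Oy). Qed.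

Lemma nabla_endoE F X Y y : smooth_on O F -> smooth_on O X -> smooth_on O Y -> O y ->
  nabla_endo nab F X Y y = Y y *m covE (X y) F y.
Proof.
move=> sF sX sY Oy; rewrite /nabla_endo /= (nabla_covV sX (smooth_vecmul O_open sY sF) Oy).
by rewrite (covV_mul nab Oy _ sY sF) /endo_app (nabla_covV sX sY Oy) addrC addKr.
Qed.

Lemma nijenhuisE F X Y y : smooth_on O F -> smooth_on O X -> smooth_on O Y -> O y ->
  nijenhuis nab F X Y y = Y y *m covE (X y *m F y) F y - X y *m covE (Y y *m F y) F y
    - Y y *m covE (X y) F y *m F y + X y *m covE (Y y) F y *m F y.
Proof.
move=> sF sX sY Oy; rewrite /nijenhuis {3 4}/endo_app.
have sXF := smooth_vecmul O_open sX sF; have sYF := smooth_vecmul O_open sY sF.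
rewrite (nabla_endoE sF sXF sY Oy) (nabla_endoE sF sYF sX Oy).
by rewrite (nabla_endoE sF sX sY Oy) (nabla_endoE sF sY sX Oy).
Qed.

Lemma sigmaE X y : smooth_on O X -> O y ->
  sigma D c X y = mxform (g y) (covV (X y) U y) (V y).
Proof. by move=> sX Oy; rewrite /sigma /bil_app (nabla_covV sX sU Oy). Qed.

Lemma tensor_SE X Y y : smooth_on O X -> smooth_on O Y -> O y ->
  tensor_S D c X Y y = normality (g y) (G y) (H y) (U y) (V y)
    (fun w => covV w U y) (fun w => covE w G y) (X y) (Y y).
Proof.
move=> sX sY Oy; rewrite /tensor_S (nijenhuisE sG sX sY Oy) !form_vE //.
rewrite (sigmaE sX Oy) (sigmaE sY Oy).
by rewrite (sigmaE (smooth_vecmul O_open sX sG) Oy) (sigmaE (smooth_vecmul O_open sY sG) Oy).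
Qed.

Lemma covV_UV x y : O y ->
  mxform (g y) (covV x V y) (U y) = - mxform (g y) (covV x U y) (V y).
Proof.
move=> Oy; have UV0 q : O q -> mxform (g q) (V q) (U q) = 0.
  by move=> Oq; exact: (dotVU (chart_contact_alg Oq)).
rewrite (metric_cov_const O_open lc g_smooth Oy x sV sU UV0).
by rewrite (ca_sym (chart_contact_alg Oy)).
Qed.

Lemma tensor_TE X Y y : smooth_on O X -> smooth_on O Y -> O y ->
  tensor_T D c X Y y = normality (g y) (H y) (- G y) (V y) (- U y)
    (fun w => covV w V y) (fun w => covE w H y) (X y) (Y y).
Proof.
move=> sX sY Oy; rewrite /tensor_T (nijenhuisE sH sX sY Oy) !form_uE //.
rewrite (sigmaE sX Oy) (sigmaE sY Oy).
rewrite (sigmaE (smooth_vecmul O_open sX sH) Oy) (sigmaE (smooth_vecmul O_open sY sH) Oy).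
by rewrite (normality_dual _ _ _ (chart_contact_alg Oy) (fun w => covV_UV w Oy)).
Qed.

(** Normality speaks of fields that are horizontal on the whole chart; projecting a constant field
    extends a vector that is horizontal at one point to such a field. *)
Definition horizontal_ext (x : E) : vf := fun q =>
  x + - (mxform (g q) x (U q) *: U q) + - (mxform (g q) x (V q) *: V q).

Lemma smooth_horizontal_ext x : smooth_on O (horizontal_ext x).
Proof.
have sx := smooth_cst (O := O) x.
have sp X : smooth_on O X -> smooth_on O (fun q => - (mxform (g q) x (X q) *: X q)).
  move=> sX; apply: (smooth_opp O_open); apply: (smooth_scale O_open _ sX).
  exact: (smooth_mxform O_open g_smooth sx sX).
exact: (smooth_add O_open (smooth_add O_open sx (sp _ sU)) (sp _ sV)).
Qed.

Lemma horizontal_horizontal_ext x : horizontal D c (horizontal_ext x).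
Proof.
move=> y Oy; have ca := chart_contact_alg Oy.
rewrite form_uE // form_vE // /horizontal_ext !mxformE (ca_UU ca) (ca_VV ca) (ca_UV ca) (dotVU ca).
by split; ring.
Qed.

Lemma horizontal_extE x y : mxform (g y) x (U y) = 0 -> mxform (g y) x (V y) = 0 ->
  horizontal_ext x y = x.
Proof. by move=> xU xV; rewrite /horizontal_ext xU xV !scale0r !oppr0 !addr0. Qed.

Hypothesis sas : complex_sasakian D.

Lemma ext_d_cst (w : E -> 'cV[R]_m) (X : vf) x z y : O y ->
  (forall Z q, O q -> form_app w Z q = mxform (g q) (Z q) (X q)) ->
  2 * ext_d w (cst x) (cst z) y =
  'D_x (fun q => mxform (g q) z (X q)) y - 'D_z (fun q => mxform (g q) x (X q)) y.
Proof.
move=> Oy wX; rewrite /ext_d /vf_deriv /bracket.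
have E a b : 'D_(cst a y) (form_app w (cst b)) y = 'D_a (fun q => mxform (g q) b (X q)) y.
  by apply: (derive_eq_on O_open _ _ Oy) => q Oq; exact: wX.
have b0 : form_app w (fun q => 'D_(cst x q) (cst z) q - 'D_(cst z q) (cst x) q) y = 0.
  by rewrite /form_app !derive_cst subrr mul0mx mxE.
by rewrite b0 (E x z) (E z x) subr0 mulrA mulfV ?mul1r.
Qed.

Lemma chart_dU x z y : O y -> 2 * mxform (g y) x (z *m G y) =
  'D_x (fun q => mxform (g q) z (U q)) y - 'D_z (fun q => mxform (g q) x (U q)) y.
Proof.
move=> Oy; have [+ _] := sas.2 c (cst x) (cst z) (smooth_cst x) (smooth_cst z) y Oy.
by move=> E; rewrite -(ext_d_cst x z Oy form_uE) -E.
Qed.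

Lemma chart_dV x z y : O y -> 2 * mxform (g y) x (z *m H y) =
  'D_x (fun q => mxform (g q) z (V q)) y - 'D_z (fun q => mxform (g q) x (V q)) y.
Proof.
move=> Oy; have [_ +] := sas.2 c (cst x) (cst z) (smooth_cst x) (smooth_cst z) y Oy.
by move=> E; rewrite -(ext_d_cst x z Oy form_vE) -E.
Qed.

Lemma chart_local_contact : local_contact O g nab G H U V.
Proof.
have [norm _] := sas; split=> //.
- exact: chart_contact_alg.
- exact: chart_dU.
- exact: chart_dV.
- move=> x y Oy; have [_ /(_ (cst x) (smooth_cst x) y Oy)[+ _]] := norm c.
  by rewrite (tensor_SE (smooth_cst x) sU Oy).
- move=> x z y Oy [xU xV] [zU zV].
  have [+ _] := (norm c).1 _ _ (smooth_horizontal_ext x) (smooth_horizontal_ext z)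
    (horizontal_horizontal_ext x) (horizontal_horizontal_ext z) y Oy.
  by rewrite (tensor_SE (smooth_horizontal_ext x) (smooth_horizontal_ext z) Oy) !horizontal_extE.
Qed.

Lemma chart_local_contact_dual : local_contact O g nab H (fun y => - G y) V (fun y => - U y).
Proof.
have [norm _] := sas.
have sNU : smooth_on O (fun y => - U y) by exact: (smooth_opp O_open sU).
have sNG : smooth_on O (fun y => - G y) by exact: (smooth_opp O_open sG).
split=> //.
- by move=> y Oy; exact: (contact_alg_dual (chart_contact_alg Oy)).
- exact: chart_dV.
- move=> x z y Oy; rewrite mulmxN mxformNr mulrN (chart_dU x z Oy).
  have Neg a b : 'D_a (fun q => mxform (g q) b (- U q)) y = - 'D_a (fun q => mxform (g q) b (U q)) y.
    rewrite -(derive_opp Oy a (smooth_mxform O_open g_smooth (smooth_cst b) sU)).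
    by apply: (derive_eq_on O_open _ _ Oy) => q _; rewrite mxformNr.
  by rewrite (Neg x z) (Neg z x); move: ('D_x _ y) ('D_z _ y) => A B; ring.
- move=> x y Oy; have [_ /(_ (cst x) (smooth_cst x) y Oy)[_ +]] := norm c.
  by rewrite (tensor_TE (smooth_cst x) sV Oy).
- move=> x z y Oy [xV xU'] [zV zU'].
  have xU : mxform (g y) x (U y) = 0 by rewrite -[LHS]opprK -mxformNr xU' oppr0.
  have zU : mxform (g y) z (U y) = 0 by rewrite -[LHS]opprK -mxformNr zU' oppr0.
  have [_ +] := (norm c).1 _ _ (smooth_horizontal_ext x) (smooth_horizontal_ext z)
    (horizontal_horizontal_ext x) (horizontal_horizontal_ext z) y Oy.
  by rewrite (tensor_TE (smooth_horizontal_ext x) (smooth_horizontal_ext z) Oy) !horizontal_extE.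
Qed.

Lemma ricci_ric a b y : O y -> ricci nab (cst a) (cst b) y = ric (fun x z => Rm nab x z y) a b.
Proof.
move=> Oy; rewrite /ricci /ric /mxtrace -sumrN; apply: eq_bigr => i _.
by rewrite /coord_vf (curv_cst O_open lc _ _ _ Oy) Rm_anti mulmxN mxE [in RHS]mxE.
Qed.

Lemma scalar_curv_scal y : O y -> scalar_curv g nab y = scal (g y) (fun x z => Rm nab x z y).
Proof.
by move=> Oy; apply: eq_bigr => i _; apply: eq_bigr => j _; rewrite ricci_ric.
Qed.

Lemma curv4_cst a b d e y : O y ->
  curv4 g nab (cst a) (cst b) (cst d) (cst e) y = mxform (g y) (d *m Rm nab a b y) e.
Proof. by move=> Oy; rewrite /curv4 /bil_app (curv_cst O_open lc _ _ _ Oy). Qed.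

End Chart.

(** If all the scalars vanish everywhere then $B=0$, hence the assumption that some coefficient is
    nonzero at some point. The argument is local: flatness forces all coefficients to vanish at each
    point, in particular at that one. *)
Theorem theorem4 (R : realType) (p : nat) (hp : (1 <= p)%N)
    (N : complexManifold R p.*2.+1) (D : contactData N)
    (sasakian : complex_sasakian D)
    (a : 'I_11 -> N -> R)
    (a_not_identically_zero : exists i x, a i x != 0) :
  ~ B_flat D a.
Proof.
move=> flat; have [i [x /eqP aix]] := a_not_identically_zero; apply: aix.
have [c cx] := atlas_cover x; pose y := phi (chart_of c) x.
have Oy : cod (chart_of c) y by exact: phi_cod.
have yx : psi (chart_of c) y = x by exact: phiK.
have ca := chart_contact_alg D Oy.
have cj := local_curvature_jet (@cod_open _ _ _ (chart_of c)) (nabla_levi_civita D c)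
  ((metric_tensor D).1 c) (chart_local_contact c sasakian) (chart_local_contact_dual c sasakian) Oy.
(* The horizontal dimension is $4p$, positive because $p\ge 1$. *)
have m2 : 0 < (p.*2.+1 + p.*2.+1)%:R - 2 :> R.
  rewrite subr_gt0 ltr_nat; lia.
have := B_coefficients ca cj (A := fun k => a (inord k) x) m2.
move=> /(_ _ _ (ltn_ord i)); rewrite inord_val; apply.
move=> X Y Z W; have := flat c _ _ _ _ (smooth_cst X) (smooth_cst Y) (smooth_cst Z) (smooth_cst W) y Oy.
by rewrite /tensor_B yx !curv4_cst // !ricci_ric // scalar_curv_scal.
Qed.
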